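(* Let $K$ be a field of characteristic different from $2$ and let $(V,q)$ be a nondegenerate quadratic space over $K$ of even dimension $n$. Let $\sigma$ be an orthogonal symmetry of $(V,q)$ and let $s$ be the dimension of $V^-=\{x\in V:\sigma(x)=-x\}$. Then the involution $J_q^\sigma$ of $C(V,q)$ is orthogonal if and only if $n-2s\equiv 0$ or $2 \pmod 8$ (here $n-2s$ is the trace $\mathrm{tr}(\sigma)$, viewed as an integer).
   Context: A quadratic space $(V,q)$ over $K$ is a finite dimensional $K$-vector space $V$ with a quadratic form $q$; $b_q(x,y)=\frac12(q(x+y)-q(x)-q(y))$. $C(V,q)$ is the Clifford algebra $T(V)/(x\otimes x-q(x)\cdot 1: x\in V)$, with canonical injection $i_q:V\to C(V,q)$; it is central simple over $K$ when $q$ is nondegenerate of even dimension. An involution is an anti-automorphism whose square is the identity; an involution of a central simple $K$-algebra fixing $K$ elementwise is either orthogonal or symplectic in the usual sense. An orthogonal symmetry of $(V,q)$ is a linear map $\sigma:V\to V$ with $b_q(\sigma x,\sigma y)=b_q(x,y)$ for all $x,y$ and $\sigma^2=\mathrm{id}$. $J_q^\sigma$ is the unique $K$-linear involution of $C(V,q)$ with $J_q^\sigma(i_q(x))=i_q(\sigma(x))$ for all $x\in V$. *)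

(* Defs.v *)
From HB Require Import structures.
From mathcomp Require Import all_boot all_order all_algebra.
From mathcomp Require Import finmap.
From mathcomp Require Import boolp monalg ring.

Set Implicit Arguments.
Unset Strict Implicit.
Unset Printing Implicit Defensive.

Import GRing.Theory.

Local Open Scope ring_scope.
Local Open Scope quotient_scope.

(* ssralg only makes the converse A^c a ring; it is also an algebra over the
   (commutative) base ring of A. *)
Section ConverseAlgebra.
Variables (K : comNzRingType) (A : algType K).

Local Notation Ac := (GRing.converse A).

HB.instance Definition _ := GRing.Zmodule_isLmodule.Build K Ac
  (@scalerA K A) (@scale1r K A) (@scalerDr K A) (@scalerDl K A).

Fact converse_scalerAl (a : K) (x y : Ac) : a *: (x * y) = (a *: x) * y.
Proof. exact: (@scalerAr K A a y x). Qed.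

HB.instance Definition _ := GRing.Lmodule_isLalgebra.Build K Ac
  converse_scalerAl.

Fact converse_scalerAr (a : K) (x y : Ac) : a *: (x * y) = x * (a *: y).
Proof. exact: (@scalerAl K A a y x). Qed.

HB.instance Definition _ := GRing.Lalgebra_isAlgebra.Build K Ac
  converse_scalerAr.

Lemma converse_morphM (J : {lrmorphism A -> Ac}) (x y : A) :
  J (x * y) = (J y : A) * (J x : A) :> A.
Proof. exact: (rmorphM J x y). Qed.

Lemma converse_morph1 (J : {lrmorphism A -> Ac}) : J 1 = 1 :> A.
Proof. exact: (rmorph1 J). Qed.

Lemma converse_morph_linear (J : {lrmorphism A -> Ac}) :
  linear (J : A -> A).
Proof. exact: (linearP J). Qed.

(* The square of an anti-endomorphism is an endomorphism. *)
Lemma converse_morph_sqr (J : {lrmorphism A -> Ac}) :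
  exists JJ : {lrmorphism A -> A}, forall x, JJ x = J (J x : A).
Proof.
pose f : A -> A := fun x => J (J x : A).
have fL : linear f.
  by move=> a x y; rewrite /f !(converse_morph_linear J).
have fM : monoid_morphism f.
  by split=> [|x y]; rewrite /f ?converse_morph1 // !converse_morphM.
by exists (HB.pack_for {lrmorphism A -> A} f
  (GRing.isLinear.Build K A A *:%R f fL)
  (GRing.isMonoidMorphism.Build A A f fM)).
Qed.

End ConverseAlgebra.

(* Quotient of a (not necessarily commutative) algebra by the two-sided ideal
   generated by a set of relations. An algType is by definition nontrivial, so
   the relations carry a proof that this ideal is proper. *)
Section AlgebraQuotient.
Variables (K : comNzRingType) (A : algType K).

Inductive ideal_span (S : A -> Prop) : A -> Prop :=
| ideal_span_gen x : S x -> ideal_span S x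
| ideal_span0 : ideal_span S 0
| ideal_spanD x y : ideal_span S x -> ideal_span S y -> ideal_span S (x + y)
| ideal_spanMl a x : ideal_span S x -> ideal_span S (a * x)
| ideal_spanMr a x : ideal_span S x -> ideal_span S (x * a).

Lemma ideal_span_morph (B : algType K) (f : {lrmorphism A -> B})
    (S : A -> Prop) : (forall x, S x -> f x = 0) ->
  forall x, ideal_span S x -> f x = 0.
Proof.
move=> fS x; elim=> {x} [x /fS//||x y _ fx _ fy|a x _ fx|a x _ fx].
- exact: raddf0.
- by rewrite raddfD /= fx fy addr0.
- by rewrite rmorphM /= fx mulr0.
- by rewrite rmorphM /= fx mul0r.
Qed.

Record relations := Relations {
  rels :> A -> Prop;
  relsP : ~ ideal_span rels 1
}.

Lemma relations_proper (B : algType K) (f : {lrmorphism A -> B})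
  (S : A -> Prop) : (forall x, S x -> f x = 0) -> ~ ideal_span S 1.
Proof.
move=> fS /(ideal_span_morph fS)/eqP; apply/negP.
by rewrite rmorph1 oner_neq0.
Qed.

Variable S : relations.

Definition ideal_of : {pred A} := fun x => `[< ideal_span S x >].

Lemma ideal_ofP x : reflect (ideal_span S x) (x \in ideal_of).
Proof. exact: asboolP. Qed.

Lemma ideal_ofMl a x : x \in ideal_of -> a * x \in ideal_of.
Proof. by move/ideal_ofP=> Ix; apply/ideal_ofP/ideal_spanMl. Qed.

Lemma ideal_ofMr a x : x \in ideal_of -> x * a \in ideal_of.
Proof. by move/ideal_ofP=> Ix; apply/ideal_ofP/ideal_spanMr. Qed.

Fact ideal_of_zmod_closed : zmod_closed ideal_of.
Proof.
split=> [|x y /ideal_ofP Ix Iy]; first exact/ideal_ofP/ideal_span0.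
apply/ideal_ofP/ideal_spanD => //; apply/ideal_ofP.
by rewrite -mulN1r ideal_ofMl.
Qed.

HB.instance Definition _ :=
  GRing.isZmodClosed.Build A ideal_of ideal_of_zmod_closed.

Definition alg_quot : Type := Quotient.quot ideal_of.

HB.instance Definition _ := GRing.Zmodule.on alg_quot.

Definition quot_pi (x : A) : alg_quot := \pi_(Quotient.quot ideal_of) x.
Definition quot_repr (u : alg_quot) : A := repr u.

Lemma quot_reprK u : quot_pi (quot_repr u) = u.
Proof. exact: reprK. Qed.

Lemma quot_piP x y : (quot_pi x = quot_pi y) <-> ideal_span S (x - y).
Proof.
split=> [/eqP|/ideal_ofP].
  by rewrite /quot_pi -Quotient.idealrBE => /ideal_ofP.
by rewrite Quotient.idealrBE => /eqP.
Qed.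

Lemma quot_pi_eq0 x : (quot_pi x = 0) <-> ideal_span S x.
Proof.
have -> : 0 = quot_pi 0 by rewrite /quot_pi [RHS]raddf0.
by rewrite quot_piP subr0.
Qed.

Fact quot_pi_is_zmod_morphism : zmod_morphism quot_pi.
Proof. by move=> x y; rewrite /quot_pi raddfB. Qed.

Definition quot_one : alg_quot := quot_pi 1.
Definition quot_mul (u v : alg_quot) : alg_quot :=
  quot_pi (quot_repr u * quot_repr v).
Definition quot_scale (a : K) (u : alg_quot) : alg_quot :=
  quot_pi (a *: quot_repr u).

Let repr_piP x : ideal_span S (quot_repr (quot_pi x) - x).
Proof. by apply/quot_piP; rewrite quot_reprK. Qed.

Fact quot_piM x y : quot_mul (quot_pi x) (quot_pi y) = quot_pi (x * y).
Proof.
apply/quot_piP; set x' := quot_repr _; set y' := quot_repr _.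
have -> : x' * y' - x * y = (x' - x) * y' + x * (y' - y).
  by rewrite mulrBl mulrBr addrA subrK.
by apply: ideal_spanD; [apply: ideal_spanMr | apply: ideal_spanMl];
   apply: repr_piP.
Qed.

Fact quot_piZ a x : quot_scale a (quot_pi x) = quot_pi (a *: x).
Proof.
by apply/quot_piP; rewrite -scalerBr -mulr_algl; apply/ideal_spanMl/repr_piP.
Qed.

Let piD x y : quot_pi x + quot_pi y = quot_pi (x + y).
Proof. by rewrite /quot_pi raddfD. Qed.

Fact quot_mulA : associative quot_mul.
Proof.
by move=> u v w; rewrite -(quot_reprK u) -(quot_reprK v) -(quot_reprK w)
  !quot_piM mulrA.
Qed.

Fact quot_mul1 : left_id quot_one quot_mul.
Proof. by move=> u; rewrite -(quot_reprK u) quot_piM mul1r. Qed.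

Fact quot_mulr1 : right_id quot_one quot_mul.
Proof. by move=> u; rewrite -(quot_reprK u) quot_piM mulr1. Qed.

Fact quot_mulDl : left_distributive quot_mul +%R.
Proof.
by move=> u v w; rewrite -(quot_reprK u) -(quot_reprK v) -(quot_reprK w)
  piD !quot_piM piD mulrDl.
Qed.

Fact quot_mulDr : right_distributive quot_mul +%R.
Proof.
by move=> u v w; rewrite -(quot_reprK u) -(quot_reprK v) -(quot_reprK w)
  piD !quot_piM piD mulrDr.
Qed.

Fact quot_one_neq0 : quot_one != 0.
Proof. by apply/eqP => /quot_pi_eq0; apply: relsP. Qed.

HB.instance Definition _ := GRing.Zmodule_isNzRing.Build alg_quot
  quot_mulA quot_mul1 quot_mulr1 quot_mulDl quot_mulDr quot_one_neq0.

HB.instance Definition _ := GRing.isZmodMorphism.Build A alg_quot quot_pi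
  quot_pi_is_zmod_morphism.

Fact quot_pi_is_monoid_morphism : monoid_morphism quot_pi.
Proof. by split=> // x y; rewrite -quot_piM. Qed.

HB.instance Definition _ := GRing.isMonoidMorphism.Build A alg_quot quot_pi
  quot_pi_is_monoid_morphism.

Fact quot_scalerA a b u : quot_scale a (quot_scale b u) = quot_scale (a * b) u.
Proof. by rewrite -(quot_reprK u) !quot_piZ scalerA. Qed.

Fact quot_scale1r : left_id 1 quot_scale.
Proof. by move=> u; rewrite -(quot_reprK u) quot_piZ scale1r. Qed.

Fact quot_scalerDr : right_distributive quot_scale +%R.
Proof.
by move=> a u v; rewrite -(quot_reprK u) -(quot_reprK v) piD !quot_piZ piD
  scalerDr.
Qed.

Fact quot_scalerDl u : {morph quot_scale^~ u : a b / a + b}.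
Proof. by move=> a b; rewrite -(quot_reprK u) !quot_piZ piD scalerDl. Qed.

HB.instance Definition _ := GRing.Zmodule_isLmodule.Build K alg_quot
  quot_scalerA quot_scale1r quot_scalerDr quot_scalerDl.

Let piZ a x : a *: quot_pi x = quot_pi (a *: x).
Proof. exact: quot_piZ. Qed.

Fact quot_scalerAl (a : K) (u v : alg_quot) : a *: (u * v) = (a *: u) * v.
Proof.
by rewrite -(quot_reprK u) -(quot_reprK v) -rmorphM !piZ -rmorphM scalerAl.
Qed.

HB.instance Definition _ := GRing.Lmodule_isLalgebra.Build K alg_quot
  quot_scalerAl.

Fact quot_scalerAr (a : K) (u v : alg_quot) : a *: (u * v) = u * (a *: v).
Proof.
by rewrite -(quot_reprK u) -(quot_reprK v) -rmorphM !piZ -rmorphM scalerAr.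
Qed.

HB.instance Definition _ := GRing.Lalgebra_isAlgebra.Build K alg_quot
  quot_scalerAr.

Fact quot_pi_is_scalable : scalable quot_pi.
Proof. by move=> a x; rewrite /= piZ. Qed.

HB.instance Definition _ := GRing.isScalable.Build K A alg_quot *:%R quot_pi
  quot_pi_is_scalable.

Section Lift.
Variables (B : algType K) (f : {lrmorphism A -> B}).
Hypothesis fS : forall x, S x -> f x = 0.

Definition quot_lift of (forall x, S x -> f x = 0) : alg_quot -> B :=
  fun u => f (quot_repr u).

Lemma quot_lift_pi x : quot_lift fS (quot_pi x) = f x.
Proof.
apply/eqP; rewrite -subr_eq0 -raddfB /=.
by apply/eqP; apply: (ideal_span_morph fS); apply: repr_piP.
Qed.

Let liftE := quot_lift_pi.

Fact quot_lift_is_zmod_morphism : zmod_morphism (quot_lift fS).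
Proof.
by move=> u v; rewrite -(quot_reprK u) -(quot_reprK v) -raddfB !liftE raddfB.
Qed.

HB.instance Definition _ := GRing.isZmodMorphism.Build alg_quot B (quot_lift fS)
  quot_lift_is_zmod_morphism.

Fact quot_lift_is_monoid_morphism : monoid_morphism (quot_lift fS).
Proof.
split=> [|u v]; first by rewrite -(rmorph1 quot_pi) liftE rmorph1.
by rewrite -(quot_reprK u) -(quot_reprK v) -rmorphM !liftE rmorphM.
Qed.

HB.instance Definition _ := GRing.isMonoidMorphism.Build alg_quot B
  (quot_lift fS) quot_lift_is_monoid_morphism.

Fact quot_lift_is_scalable : scalable (quot_lift fS).
Proof. by move=> a u; rewrite -(quot_reprK u) -linearZ !liftE linearZ. Qed.

HB.instance Definition _ := GRing.isScalable.Build K alg_quot B *:%R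
  (quot_lift fS) quot_lift_is_scalable.

End Lift.

End AlgebraQuotient.

(* The free algebra on the underlying set of V. *)
Section FreeAlgebra.
Variables (K : fieldType) (V : choiceType).

Fact free_scalerAr (a : K) (x y : {malg K[{fmonom V}]}) :
  a *: (x * y) = x * (a *: y).
Proof.
apply/malgP=> k; rewrite mcoeffZ mcoeffMl mulr_sumr.
rewrite (mcoeffMlw _ (fsubset_refl _) (msuppZ_le _ _)).
apply: eq_bigr => k1 _; rewrite mulr_sumr; apply: eq_bigr => k2 _.
by rewrite mcoeffZ mulrnAr mulrCA.
Qed.

Definition free_alg : Type := {malg K[{fmonom V}]}.

HB.instance Definition _ := GRing.Lalgebra.on free_alg.

HB.instance Definition _ := GRing.Lalgebra_isAlgebra.Build K free_alg
  free_scalerAr.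

Definition free_gen (x : V) : free_alg := << fmu x >>.

Section Lift.
Variables (B : algType K) (f : V -> B).

Definition free_lift_word (w : {fmonom V}) : B := \prod_(x <- (w : seq V)) f x.

Fact free_lift_word_is_mmorphism : mmorphism free_lift_word.
Proof.
by split=> [w1 w2|]; rewrite /free_lift_word ?fmM ?fm1 ?big_cat ?big_nil.
Qed.

HB.instance Definition _ := monalg.isMultiplicative.Build {fmonom V} B
  free_lift_word free_lift_word_is_mmorphism.

Definition free_lift : free_alg -> B := mmap (in_alg B) free_lift_word.

HB.instance Definition _ := GRing.Additive.copy free_lift
  (mmap (in_alg B) free_lift_word).

Fact free_lift_is_monoid_morphism : monoid_morphism free_lift.
Proof.
have [] := @commr_mmap_is_multiplicative _ _ _ (in_alg B) free_lift_word.
  by move=> g m m'; rewrite /GRing.comm /= mulr_algl mulr_algr.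
by move=> fM f1; split.
Qed.

HB.instance Definition _ := GRing.isMonoidMorphism.Build free_alg B
  free_lift free_lift_is_monoid_morphism.

Fact free_lift_is_scalable : scalable free_lift.
Proof.
by move=> a x; rewrite /free_lift [LHS]mmapZ -[in RHS]mulr_algl.
Qed.

HB.instance Definition _ := GRing.isScalable.Build K free_alg B *:%R
  free_lift free_lift_is_scalable.

Lemma free_lift_gen x : free_lift (free_gen x) = f x.
Proof.
by rewrite /free_lift mmapU /free_lift_word fmU big_seq1 /= scale1r mul1r.
Qed.

End Lift.

Lemma free_ext (B : algType K) (f g : {lrmorphism free_alg -> B}) :
  (forall x, f (free_gen x) = g (free_gen x)) -> f =1 g.
Proof.
move=> fg x.
have hZ (h : {lrmorphism free_alg -> B}) c w :
    h << c *g w >> = c *: h << w >>.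
  rewrite -linearZ /=; congr (h _); apply/malgP=> k.
  by rewrite mcoeffZ !mcoeffU mulrnAr mulr1.
have hE (h : {lrmorphism free_alg -> B}) :
    h x = \sum_(w <- msupp x) x@_w *: h << w >>.
  transitivity (h (\sum_(w <- msupp x) << x@_w *g w >>)).
    by rewrite -monalgE.
  transitivity (\sum_(w <- msupp x) h << x@_w *g w >>).
    exact: raddf_sum.
  by apply: eq_bigr => w _; apply: hZ.
rewrite (hE f) (hE g); apply: eq_bigr => w _; congr (_ *: _).
case: w => s; elim: s => [|a s IHs].
  have -> : << FMonom [::] >> = 1 :> free_alg.
    by congr (<< _ >>); apply/val_inj; rewrite /= fm1.
  by rewrite !rmorph1.
have -> : << FMonom (a :: s) >> = free_gen a * << FMonom s >> :> free_alg.
  rewrite [RHS]fgmulUU mulr1; congr (<< _ >>); apply/val_inj.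
  by rewrite /= fmM fmU.
by rewrite !rmorphM /= fg /= IHs.
Qed.

End FreeAlgebra.

(* T(V): the free algebra on the set V modulo the linearity relations. *)
Section TensorAlgebra.
Variables (K : fieldType) (V : lmodType K).

Inductive tensor_rel : free_alg K V -> Prop :=
  TensorRel (a : K) (u v : V) :
    tensor_rel (free_gen K (a *: u + v) - (a *: free_gen K u + free_gen K v)).

Fact tensor_rel_lift (B : algType K) (f : {linear V -> B}) x :
  tensor_rel x -> free_lift f x = 0.
Proof.
case=> a u v; rewrite raddfB /= raddfD /= linearZ /= !free_lift_gen.
by rewrite linearP subrr.
Qed.

Fact tensor_rel_proper : ~ ideal_span tensor_rel 1.
Proof.
exact: (relations_proper (@tensor_rel_lift K^o \0)).
Qed.

Definition tensor_alg : algType K := alg_quot (Relations tensor_rel_proper).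

Definition tensor_in (v : V) : tensor_alg := quot_pi _ (free_gen K v).

Fact tensor_in_is_linear : linear tensor_in.
Proof.
move=> a u v; rewrite /tensor_in -linearZ -raddfD.
by apply/quot_piP/ideal_span_gen.
Qed.

HB.instance Definition _ := GRing.isLinear.Build K V tensor_alg *:%R tensor_in
  tensor_in_is_linear.

Definition tensor_lift (B : algType K) (f : {linear V -> B}) :
    {lrmorphism tensor_alg -> B} :=
  quot_lift (S := Relations tensor_rel_proper) (tensor_rel_lift f).

Lemma tensor_lift_in (B : algType K) (f : {linear V -> B}) v :
  tensor_lift f (tensor_in v) = f v.
Proof. by rewrite [LHS]quot_lift_pi; apply: free_lift_gen. Qed.

Lemma tensor_ext (B : algType K) (f g : {lrmorphism tensor_alg -> B}) :
  (forall v, f (tensor_in v) = g (tensor_in v)) -> f =1 g.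
Proof.
move=> fg u; rewrite -[u]quot_reprK.
exact: (@free_ext _ _ _ (f \o @quot_pi _ _ _) (g \o @quot_pi _ _ _)).
Qed.

End TensorAlgebra.

(* In any characteristic: q is homogeneous of degree 2 and its polar form is
   bilinear (it is visibly symmetric, so linearity on one side suffices). *)
Record quadratic_form (K : fieldType) (V : lmodType K) := QuadraticForm {
  qf :> V -> K;
  qfZ : forall a x, qf (a *: x) = a ^+ 2 * qf x;
  qf_polar : forall y, scalar (fun x => qf (x + y) - qf x - qf y)
}.

Definition bq (K : fieldType) (V : lmodType K) (q : quadratic_form V) (x y : V)
  : K := 2^-1 * (q (x + y) - q x - q y).

Definition nondegenerate_qf (K : fieldType) (V : lmodType K)
  (q : quadratic_form V) : Prop := forall x, (forall y, bq q x y = 0) -> x = 0.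

Section QuadraticFormTheory.
Variables (K : fieldType) (V : lmodType K) (q : quadratic_form V).

Let p x y := q (x + y) - q x - q y.

Lemma qf0 : q 0 = 0.
Proof. by rewrite -(scale0r 0) qfZ expr0n mul0r. Qed.

Let p0 y : p 0 y = 0.
Proof. by rewrite /p add0r qf0 subr0 subrr. Qed.

Let pD x x' y : p (x + x') y = p x y + p x' y.
Proof. by have := qf_polar q y 1 x x'; rewrite scale1r mul1r. Qed.

Let pZ a x y : p (a *: x) y = a * p x y.
Proof. by have := qf_polar q y a x 0; rewrite addr0 -/(p 0 y) p0 addr0. Qed.

Let psum (I : Type) (r : seq I) (F : I -> V) y :
  p (\sum_(i <- r) F i) y = \sum_(i <- r) p (F i) y.
Proof.
by elim: r => [|i r IHr]; rewrite ?(big_nil, big_cons) ?p0 // pD IHr.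
Qed.

Lemma bqxx x : (2 : K) != 0 -> bq q x x = q x.
Proof.
move=> K2; rewrite /bq -[x + x]mulr2n -scaler_nat qfZ.
apply: (mulfI K2); rewrite mulrA divff // mul1r.
by ring.
Qed.

Lemma qf_sum n (u : 'I_n -> V) :
  q (\sum_i u i) = \sum_i (q (u i) + \sum_(j < n | (j < i)%N) p (u j) (u i)).
Proof.
elim: n u => [|n IHn] u; first by rewrite !big_ord0 qf0.
rewrite big_ord_recr [RHS]big_ord_recr /=.
set s := \sum_(i < n) _; set e := u ord_max.
have -> : q (s + e) = q s + (q e + p s e).
  by rewrite /p; ring.
rewrite /s IHn; congr (_ + (_ + _)).
  apply: eq_bigr => i _; congr (_ + _).
  rewrite [RHS]big_mkcond big_ord_recr /= -big_mkcond ltnNge ltnW //= addr0.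
  exact: eq_bigl.
rewrite psum [RHS]big_mkcond big_ord_recr /= ltnn addr0; apply: eq_bigr => i _.
by rewrite ltn_ord.
Qed.

End QuadraticFormTheory.

(* C(V, q) is nontrivial: V acts on a space of fermionic states by a sum of
   creation and annihilation operators. *)
Section CliffordNontrivial.
Variable K : fieldType.

Lemma fermions n : exists m (g : bool -> nat -> 'M[K]_m.+1),
  (forall a i, (i < n)%N -> g a i * g a i = 0) /\
  (forall a b i j, (i < n)%N -> (j < n)%N ->
     g a i * g b j + g b j * g a i = ((a != b) && (i == j))%:R).
Proof.
elim: n => [|n [m [g [gg gC]]]]; first by exists 0, (fun _ _ => 0).
pose e a : 'M[K]_(m.+1 + m.+1) :=
  if a then block_mx 0 1 0 0 else block_mx 0 0 1 0.
pose h a i : 'M[K]_(m.+1 + m.+1) :=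
  if (i < n)%N then block_mx (g a i) 0 0 (- g a i) else e a.
exists (m + m.+1)%N, h.
have hlt a i : (i < n)%N -> h a i = block_mx (g a i) 0 0 (- g a i).
  by rewrite /h => ->.
have hn a : h a n = e a by rewrite /h ltnn.
pose simp := (mulmx_block, mulmx0, mul0mx, mulNmx, mulmxN, opprK, add0r, addr0).
have mE (A B : 'M[K]_m.+1) : A *m B = A * B by [].
have he a b i : (i < n)%N -> h a i *m e b + e b *m h a i = 0.
  move=> lt_in; rewrite hlt // /e.
  by case: b; rewrite !simp add_block_mx !simp !mE mulr1 mul1r ?subrr ?addNr
    block_mx0.
have hh a i : (i < n.+1)%N -> h a i *m h a i = 0.
  rewrite ltnS leq_eqVlt; case/predU1P => [->|lt_in].
    by rewrite hn /e; case: a; rewrite !simp block_mx0.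
  by rewrite hlt // !simp !mE gg // ?oppr0 block_mx0.
have hC a b i j : (i < n.+1)%N -> (j < n.+1)%N ->
    h a i *m h b j + h b j *m h a i = ((a != b) && (i == j))%:R%:M.
  rewrite !ltnS leq_eqVlt [(j <= n)%N]leq_eqVlt.
  case/predU1P => [->|lt_in] /predU1P[->|lt_jn].
  - rewrite !hn eqxx andbT /e; case: a b => [] [];
      rewrite !simp add_block_mx !simp ?block_mx0 ?raddf0 // !mE mulr1;
      exact: esym (scalar_mx_block _ _ 1).
  - by rewrite hn addrC he // gtn_eqF // andbF raddf0.
  - by rewrite hn he // ltn_eqF // andbF raddf0.
  rewrite !hlt // !simp add_block_mx !simp !mE gC //.
  case: (_ && _); last by rewrite block_mx0 raddf0.
  exact: esym (scalar_mx_block _ _ 1).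
split=> [a i lt_i|a b i j lt_i lt_j]; first exact: hh.
apply: etrans (hC a b i j lt_i lt_j) _.
by case: (_ && _); rewrite ?raddf0.
Qed.

Lemma sum_anticomm_sqr (A : nzRingType) n (u : 'I_n -> A) :
    (forall i j, i != j -> u i * u j + u j * u i = 0) ->
  (\sum_i u i) * (\sum_i u i) = \sum_i u i * u i.
Proof.
elim: n u => [|n IHn] u uC; first by rewrite !big_ord0 mul0r.
rewrite !big_ord_recr /= mulrDl !mulrDr IHn => [|i j ij]; last exact: uC.
rewrite -addrA; congr (_ + _); rewrite addrA mulr_suml mulr_sumr -big_split /=.
by rewrite big1 ?add0r // => i _; apply: uC; rewrite neq_ltn /= ltn_ord.
Qed.

Variables (V : vectType K) (q : quadratic_form V).

Lemma clifford_nontrivial : exists m (f : {linear V -> 'M[K]_m.+1}),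
  forall v, f v * f v = (q v)%:A.
Proof.
pose n := \dim {:V}; pose X := vbasis {:V}.
have [m [g [gg gC]]] := fermions n; exists m.
pose x v (i : 'I_n) := coord X i v.
pose p u v := q (u + v) - q u - q v.
pose y v (i : 'I_n) := q X`_i * x v i
  + \sum_(j < n | (j < i)%N) x v j * p X`_j X`_i.
pose f v := \sum_i (x v i *: g true i + y v i *: g false i).
have xL i : scalar (x^~ i) by move=> a u v; rewrite /x linearP.
have yL i : scalar (y^~ i).
  move=> a u v; rewrite /y.
  have -> : \sum_(j < n | (j < i)%N) x (a *: u + v) j * p X`_j X`_i
      = a * (\sum_(j < n | (j < i)%N) x u j * p X`_j X`_i)
        + \sum_(j < n | (j < i)%N) x v j * p X`_j X`_i.
    rewrite mulr_sumr -big_split; apply: eq_bigr => j _ /=.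
    by rewrite xL mulrDl mulrA.
  by rewrite xL; ring.
have fL : linear f.
  move=> a u v; rewrite /f scaler_sumr -big_split; apply: eq_bigr => i _ /=.
  rewrite xL yL scalerDr !scalerA.
  by rewrite [X in X + _]scalerDl [X in _ + X]scalerDl addrACA.
have qE v : q v = \sum_i x v i * y v i.
  rewrite {1}(coord_vbasis (memvf v)) qf_sum; apply: eq_bigr => i _.
  rewrite /y mulrDr; congr (_ + _); first by rewrite qfZ /x; ring.
  rewrite mulr_sumr; apply: eq_bigr => j _.
  have pZl a u w : p (a *: u) w = a * p u w.
    have := qf_polar q w a u 0.
    by rewrite addr0 add0r qf0 subr0 subrr addr0.
  have pC u w : p u w = p w u by rewrite /p [w + u]addrC addrAC.
  rewrite -[LHS]/(p _ _) pZl [p _ (_ *: _)]pC pZl mulrCA.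
  by rewrite [p X`_i _]pC.
exists (HB.pack_for {linear V -> 'M[K]_m.+1} f
  (GRing.isLinear.Build _ _ _ _ f fL)) => v /=.
have uC i j : i != j ->
    (x v i *: g true i + y v i *: g false i)
      * (x v j *: g true j + y v j *: g false j)
    + (x v j *: g true j + y v j *: g false j)
      * (x v i *: g true i + y v i *: g false i) = 0.
  move=> ij; have gC0 a b : g a i * g b j + g b j * g a i = 0.
    by rewrite gC ?ltn_ord // (inj_eq val_inj) (negPf ij) andbF.
  have gCz a b c d :
      (c *: g a i) * (d *: g b j) + (d *: g b j) * (c *: g a i) = 0.
    rewrite -!scalerAl -!scalerAr !scalerA [d * c]mulrC -scalerDr gC0.
    by rewrite scaler0.
  rewrite [X in X + _]mulrDl [X in _ + X]mulrDr addrACA !mulrDr !mulrDl.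
  by rewrite [X in X + _]addrACA [X in _ + X]addrACA !gCz !addr0.
rewrite sum_anticomm_sqr // qE scaler_suml; apply: eq_bigr => i _.
move: (x v i) (y v i) => a b.
rewrite mulrDl !mulrDr -!scalerAl -!scalerAr !gg ?ltn_ord // !scaler0.
rewrite add0r addr0 !scalerA [b * a]mulrC -scalerDr gC ?ltn_ord //.
by rewrite eqxx.
Qed.

End CliffordNontrivial.

(* C(V, q) = T(V) / (v (x) v - q(v).1). *)
Section Clifford.
Variables (K : fieldType) (V : vectType K) (q : quadratic_form V).

Inductive clifford_rel : tensor_alg V -> Prop :=
  CliffordRel (v : V) :
    clifford_rel (tensor_in v * tensor_in v - (q v)%:A).

Fact clifford_rel_lift (B : algType K) (f : {linear V -> B}) :
  (forall v, f v * f v = (q v)%:A) ->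
  forall x, clifford_rel x -> tensor_lift f x = 0.
Proof.
move=> fq x; case=> v; move: (tensor_lift f) (tensor_lift_in f) => g gE.
by rewrite rmorphB /= rmorphM /= linearZ /= rmorph1 !gE fq subrr.
Qed.

Fact clifford_rel_proper : ~ ideal_span clifford_rel 1.
Proof.
have [m [f fq]] := clifford_nontrivial q.
exact: relations_proper (clifford_rel_lift fq).
Qed.

Definition clifford : algType K := alg_quot (Relations clifford_rel_proper).

Definition clifford_in (v : V) : clifford := quot_pi _ (tensor_in v).

Fact clifford_in_is_linear : linear clifford_in.
Proof. by move=> a u v; rewrite /clifford_in !linearP. Qed.

HB.instance Definition _ := GRing.isLinear.Build K V clifford *:%R clifford_in
  clifford_in_is_linear.

Lemma clifford_in_sqr v : clifford_in v * clifford_in v = (q v)%:A.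
Proof.
rewrite /clifford_in -rmorphM -(rmorph1 (quot_pi _)) -linearZ.
by apply/quot_piP/ideal_span_gen.
Qed.

Definition clifford_lift (B : algType K) (f : {linear V -> B})
    (fq : forall v, f v * f v = (q v)%:A) : {lrmorphism clifford -> B} :=
  quot_lift (S := Relations clifford_rel_proper) (clifford_rel_lift fq).

Lemma clifford_lift_in (B : algType K) (f : {linear V -> B})
    (fq : forall v, f v * f v = (q v)%:A) v :
  clifford_lift fq (clifford_in v) = f v.
Proof. by rewrite [LHS]quot_lift_pi; apply: tensor_lift_in. Qed.

Lemma clifford_ext (B : algType K) (f g : {lrmorphism clifford -> B}) :
  (forall v, f (clifford_in v) = g (clifford_in v)) -> f =1 g.
Proof.
move=> fg u; rewrite -[u]quot_reprK.
exact: (@tensor_ext _ _ _ (f \o @quot_pi _ _ _) (g \o @quot_pi _ _ _)).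
Qed.

End Clifford.

(* A K-linear anti-automorphism of A of order at most 2. *)
Record is_involution (K : fieldType) (A : algType K) (J : A -> A) : Prop := {
  involution_linear : linear J;
  involution1 : J 1 = 1;
  involutionM : forall x y, J (x * y) = J y * J x;
  involutionK : involutive J
}.

(* phi, semilinear along iota : K -> L, identifies A (x)_K L with M_m(L): some
   K-basis of A is sent by phi to an L-basis of M_m(L). *)
Definition is_splitting (K : fieldType) (A : algType K) (L : fieldType)
    (iota : {rmorphism K -> L}) (m : nat)
    (phi : {lrmorphism A -> 'M[L]_m.+1 | iota \; *:%R}) : Prop :=
  exists d (e : d.-tuple A),
    (forall x, exists! c : 'rV[K]_d, x = \sum_(i < d) c 0 i *: tnth e i) /\
    basis_of {:'M[L]_m.+1} [seq phi x | x <- e].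

(* After extension of scalars to some splitting field, J becomes the adjoint
   involution of a nonsingular symmetric bilinear form
   b(u, v) = u^T *m B *m v, that is b(J(x) u, v) = b(u, x v). Meant for
   characteristic different from 2, where the form is either symmetric or
   alternating, the latter being the symplectic case; which of the two occurs
   does not depend on the splitting. *)
Definition orthogonal_involution (K : fieldType) (A : algType K) (J : A -> A)
    : Prop :=
  is_involution J /\
  exists (L : fieldType) (iota : {rmorphism K -> L}) (m : nat)
      (phi : {lrmorphism A -> 'M[L]_m.+1 | iota \; *:%R})
      (B : 'M[L]_m.+1),
    [/\ is_splitting phi, B \in unitmx, B^T = B
      & forall x, (phi (J x))^T *m B = B *m phi x].

Section CliffordInvolution.
Variables (K : fieldType) (V : vectType K) (q : quadratic_form V).

Record orthogonal_symmetry (sigma : 'End(V)) : Prop := {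
  symmetry_isometry : forall x y, bq q (sigma x) (sigma y) = bq q x y;
  symmetryK : involutive sigma
}.

(* J is the involution J_q^sigma of C(V, q). *)
Definition is_clifford_involution (sigma : 'End(V))
    (J : clifford q -> clifford q) : Prop :=
  is_involution J /\
  forall x, J (clifford_in q x) = clifford_in q (sigma x).

Let conv_lrmorphism (J : clifford q -> clifford q) (HJ : is_involution J) :
  exists J' : {lrmorphism clifford q -> GRing.converse (clifford q)},
    J' =1 J :> (_ -> clifford q).
Proof.
case: HJ => JL J1 JM _.
pose Jc : clifford q -> GRing.converse (clifford q) := J.
pose lin := GRing.isLinear.Build K (clifford q)
  (GRing.converse (clifford q)) *:%R Jc JL.
pose mul := GRing.isMonoidMorphism.Build (clifford q)
  (GRing.converse (clifford q)) Jc (conj J1 JM).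
by exists (HB.pack_for
  {lrmorphism clifford q -> GRing.converse (clifford q)} Jc lin mul).
Qed.

Lemma clifford_involution_unique sigma J J' :
  is_clifford_involution sigma J -> is_clifford_involution sigma J' -> J =1 J'.
Proof.
case=> [/conv_lrmorphism[f fJ] Ji] [/conv_lrmorphism[f' fJ'] Ji'] u.
rewrite -fJ -fJ'; apply: (@clifford_ext _ _ _ _ f f') => v.
exact: etrans (fJ _) (etrans (Ji _) (esym (etrans (fJ' _) (Ji' _)))).
Qed.

Lemma clifford_involution_exists sigma : (2 : K) != 0 ->
  orthogonal_symmetry sigma -> exists J, is_clifford_involution sigma J.
Proof.
move=> K2 [sq sK].
pose C := clifford q; pose Cc := GRing.converse C.
pose f0 : V -> Cc := fun v => clifford_in q (sigma v).
have f0L : linear f0 by move=> a u v; rewrite /f0 !linearP.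
pose f := HB.pack_for {linear V -> Cc} f0
  (GRing.isLinear.Build K V Cc *:%R f0 f0L).
have fq v : f v * f v = (q v)%:A.
  rewrite [LHS](clifford_in_sqr q (sigma v)).
  by rewrite -(bqxx q (sigma v) K2) sq bqxx.
have [J Ji] : exists J : {lrmorphism C -> Cc},
    forall v, J (clifford_in q v) = f v.
  by exists (clifford_lift fq) => v; apply: clifford_lift_in.
exists J; split=> //; split.
- exact: converse_morph_linear.
- exact: converse_morph1.
- exact: converse_morphM.
have [JJ JJE] := converse_morph_sqr J.
move=> u; rewrite -JJE; apply: (@clifford_ext _ _ _ _ JJ idfun) => v.
by apply: etrans (JJE _) _; rewrite Ji [LHS]Ji /f /= /f0 sK.
Qed.

End CliffordInvolution.

(* V^- = {x | sigma x = - x}. *)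
Definition minus_space (K : fieldType) (V : vectType K) (sigma : 'End(V))
  : {vspace V} := passmx.leigenspace sigma (-1).

Lemma minus_spaceP (K : fieldType) (V : vectType K) (sigma : 'End(V)) x :
  reflect (sigma x = - x) (x \in minus_space sigma).
Proof.
rewrite /minus_space /passmx.leigenspace memv_ker !lfun_simp.
by apply: (iffP eqP) => [/eqP|->]; rewrite scaleN1r opprK ?addr_eq0 ?addNr // => /eqP.
Qed.

(* Main.v *)
Require Import Defs.
From HB Require Import structures.
From mathcomp Require Import all_boot all_order all_algebra all_field.
From mathcomp Require Import finmap.
From mathcomp Require Import boolp monalg ring zify.

(* Choose an orthogonal basis of V made of eigenvectors of sigma and let g_S
   (S a subset of the index set) be the corresponding ordered products of
   generators of C(V, q). They form a basis in which J is diagonal, with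
   J g_S = (-1)^(C(|S|, 2) + |S :&: M|) g_S, where M indexes V^-. In a splitting
   of degree N with adjoint form B, J becomes X |-> B^-1 X^T B, whose trace is
   N if B is symmetric and - N if B is alternating; on the other hand the trace
   is the sum of the above signs, evaluated with Gaussian integers as
   (-1)^C(n/2 + 3 s, 2) 2^(n/2), and N = 2^(n/2). So the sign of B is forced,
   and it remains to exhibit one splitting with a symmetric or antisymmetric B:
   over an extension containing enough square roots, C(V, q) acts by gamma
   matrices that are symmetric or antisymmetric, and B is a product of some of
   them. *)

Set Implicit Arguments.
Unset Strict Implicit.
Unset Printing Implicit Defensive.

Import GRing.Theory.
Local Open Scope ring_scope.

(** * Products of anticommuting elements *)

Lemma odd_cardsD1 (T : finType) (S : {set T}) i :
  odd #|S :\ i| = odd #|S| (+) (i \in S).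
Proof. by rewrite [#|S|](cardsD1 i) oddD oddb addbAC addbb. Qed.

(** If all these parities agree, [T] is either [S], or [~: S] with a cardinal of the other parity;
    the latter is impossible for even [n]. The parities are those of the signs by which [g i]
    commutes with [gprod S]. *)
Lemma odd_cardsD1_sep n (S T : {set 'I_n}) : ~~ odd n -> S != T ->
  exists i, odd #|S :\ i| != odd #|T :\ i|.
Proof.
move=> n_even; apply: contraNP => /forallNP noti.
have eqi i : odd #|S| (+) (i \in S) = odd #|T| (+) (i \in T).
  by rewrite -!odd_cardsD1; apply/eqP; move/negP/negPn: (noti i).
have [eqO|neqO] := eqVneq (odd #|S|) (odd #|T|).
  by apply/eqP/setP=> i; have:= eqi i; rewrite eqO => /addbI.
have defT : T = ~: S.
  apply/setP=> i; rewrite inE; have:= eqi i; move: neqO.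
  by case: (odd _) (odd _) (i \in S) (i \in T) => [] [] [] [].
have := cardsC S; rewrite -defT card_ord => /(congr1 odd).
by rewrite oddD (negPf n_even); case: (odd _) (odd _) neqO => [] [].
Qed.

(** [S] is [P] or its complement, according to the parity of the latter. This serves to prescribe
    with which generators a product commutes. *)
Lemma odd_cardsD1_surj n (P : {set 'I_n}) : ~~ odd n ->
  exists S : {set 'I_n}, forall i, odd #|S :\ i| = (i \in P).
Proof.
move=> n_even; case oddP: (odd #|~: P|).
  by exists (~: P) => i; rewrite odd_cardsD1 oddP inE addTb negbK.
exists P => i; rewrite odd_cardsD1.
have := cardsC P; rewrite card_ord => /(congr1 odd).
by rewrite oddD oddP (negPf n_even) addbF => ->.
Qed.

Section AnticommutingFamily.
Variables (K : fieldType) (A : algType K) (n : nat).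
Variables (g : 'I_n -> A) (a : 'I_n -> K).
Hypothesis g_sqr : forall i, g i * g i = (a i)%:A.
Hypothesis g_anti : forall i j, i != j -> g i * g j = - (g j * g i).

Definition gprod (S : {set 'I_n}) : A := \prod_(i in S) g i.

(** Each factor other than [g i] contributes one sign. The filtered list lets the induction follow
    the enumeration behind [gprod]. *)
Lemma anticomm_prod (r : seq 'I_n) (P : pred 'I_n) i :
  g i * (\prod_(j <- r | P j) g j) =
  (-1) ^+ count (fun j => P j && (j != i)) r *:
    ((\prod_(j <- r | P j) g j) * g i).
Proof.
elim: r => [|j r IHr]; first by rewrite !big_nil mulr1 mul1r scale1r.
rewrite !big_cons /=; case: (P j) => //=; have [->|ji] := eqVneq j i.
  by rewrite -mulrA scalerAr -IHr.
rewrite mulrA g_anti 1?eq_sym // mulNr -[in LHS]mulrA IHr exprS mulN1r scaleNr.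
by rewrite -scalerAr -[in RHS]mulrA.
Qed.

Lemma gprod_comm i S :
  g i * gprod S = (-1) ^+ #|S :\ i| *: (gprod S * g i).
Proof.
rewrite [LHS]anticomm_prod; congr (_ ^+ _ *: _).
rewrite cardE size_filter; apply: eq_count => j.
by rewrite !inE andbC.
Qed.

Lemma gprod_mull i S : exists b S', g i * gprod S = b *: gprod S'.
Proof.
have [r1 [r2 def_r]] : exists r1 r2, index_enum 'I_n = r1 ++ i :: r2.
  by case/splitPr: (mem_index_enum i) => r1 r2; exists r1, r2.
have := index_enum_uniq 'I_n; rewrite def_r cat_uniq /= negb_or.
case/and3P=> _ /andP[ir1 _] /andP[ir2 _].
(* [S'] is the symmetric difference of [S] and [{i}]; [b] collects the signs of the factors that
   [g i] passes, and [a i] if it meets itself. *)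
pose S' := if i \in S then S :\ i else i |: S.
pose b := (-1) ^+ count (fun j => (j \in S) && (j != i)) r1
  * (if i \in S then a i else 1).
exists b, S'; rewrite /gprod def_r !big_cat !big_cons /=.
have S'E j : j != i -> (j \in S') = (j \in S).
  by rewrite /S'; case: ifP => iS ji; rewrite !inE ?ji // (negPf ji).
have eqP12 r : i \notin r ->
    \prod_(j <- r | j \in S') g j = \prod_(j <- r | j \in S) g j.
  move=> ir; rewrite big_seq_cond [RHS]big_seq_cond; apply: eq_bigl => j.
  by have [->|/S'E->//] := eqVneq j i; rewrite (negPf ir).
rewrite !eqP12 // mulrA anticomm_prod -scalerAl /b.
rewrite -[RHS]scalerA; congr (_ *: _); rewrite /S'.
case: ifP => iS; rewrite !inE eqxx /= ?scale1r -?mulrA //.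
by rewrite [X in _ * X]mulrA g_sqr -scalerAl mul1r scalerAr.
Qed.

Lemma gprod_lunit S : (forall i, a i != 0) -> exists x, x * gprod S = 1.
Proof.
move=> a_neq0; rewrite /gprod.
apply: (big_ind (fun y => exists x, x * y = 1)).
- by exists 1; rewrite mulr1.
- move=> y z [y' y'y] [z' z'z]; exists (z' * y').
  by rewrite mulrA -(mulrA z') y'y mulr1.
move=> i _; exists ((a i)^-1 *: g i).
by rewrite -scalerAl g_sqr scalerA mulVf ?scale1r.
Qed.

(* Applying in turn the maps x |-> x + eps_i g_i x g_i^-1, where eps_i is the
   sign by which g_i commutes with g_T, kills every term but the one at T. *)
Lemma gprod_indep (c : {set 'I_n} -> K) : (2 : K) != 0 -> ~~ odd n ->
  (forall i, a i != 0) ->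
  \sum_S c S *: gprod S = 0 -> forall S, c S = 0.
Proof.
move=> K2 n_even a_neq0 c0 T.
pose e (S : {set 'I_n}) i : K := 1 + (-1) ^+ (#|T :\ i| + #|S :\ i|).
have step (r : seq 'I_n) : \sum_S (c S * \prod_(i <- r) e S i) *: gprod S = 0.
  elim: r => [|i r IHr].
    by rewrite -[RHS]c0; apply: eq_bigr => S _; rewrite big_nil mulr1.
  set s := \sum_S _ in IHr.
  have: s + ((-1) ^+ #|T :\ i| / a i) *: (g i * s * g i) = 0.
    by rewrite IHr mulr0 mul0r scaler0 addr0.
  rewrite mulr_sumr mulr_suml scaler_sumr -big_split /= => s0.
  rewrite -[RHS]s0; apply: eq_bigr => S _.
  rewrite -scalerAr -scalerAl gprod_comm -scalerAl -mulrA g_sqr.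
  rewrite -[_%:A]mulr_algr mul1r mulr_algr !scalerA -scalerDl; congr (_ *: _).
  rewrite big_cons /e exprD; move: (\prod_(j <- r) _) (c S) => x y.
  have := a_neq0 i.
  move: ((-1) ^+ #|T :\ i|) ((-1) ^+ #|S :\ i|) (a i) => u v b.
  move=> b0; transitivity (y * x + u * v * (y * x) * (b^-1 * b)).
    by rewrite mulVf //; ring.
  by ring.
have := step (index_enum 'I_n).
rewrite (bigD1 T) //= [X in _ + X]big1 ?addr0 => [/eqP|S neqST].
  have [x xT] := gprod_lunit T a_neq0.
  rewrite scaler_eq0 => /orP[|/eqP gT0]; last first.
    by have := oner_neq0 A; rewrite -xT gT0 mulr0 eqxx.
  rewrite mulf_eq0 => /orP[/eqP//|/prodf_eq0[i _]].
  by rewrite /e addnn -signr_odd odd_double (negPf (K2 : 1 + 1 != 0)).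
have [i sep] := odd_cardsD1_sep n_even neqST.
rewrite (bigD1_seq i) ?mem_index_enum ?index_enum_uniq //= /e.
rewrite -signr_odd oddD addbC; case: (odd _) (odd _) sep => [] [] //= _;
by rewrite expr1 subrr mul0r mulr0 scale0r.
Qed.

(** Reversing [#|S|] anticommuting factors costs ['C(#|S|, 2)] transpositions, and each factor in
    [M] one more sign. Serves both for [J] and for matrix transposition. *)
Lemma gprod_antimorph (f : A -> A) (M S : {set 'I_n}) :
  linear f -> f 1 = 1 -> (forall x y, f (x * y) = f y * f x) ->
  (forall i, f (g i) = (-1) ^+ (i \in M) *: g i) ->
  f (gprod S) = (-1) ^+ ('C(#|S|, 2) + #|S :&: M|) *: gprod S.
Proof.
move=> fL f1 fM fg.
have fZ c x : f (c *: x) = c *: f x.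
  have f0 : f 0 = 0 by have := fL (-1) 0 0; rewrite !scaleN1r !addNr.
  by rewrite -[c *: x]addr0 fL f0 addr0.
have fprod (r : seq 'I_n) : uniq r ->
    f (\prod_(i <- r | i \in S) g i)
    = (-1) ^+ ('C(count [in S] r, 2) + count [in S :&: M] r)
      *: \prod_(i <- r | i \in S) g i.
  elim: r => [|i r IHr] /=; first by rewrite !big_nil f1 scale1r.
  case/andP=> ir /IHr{}IHr; rewrite big_cons inE; case: (i \in S) => //=.
  rewrite fM fg IHr -scalerAl -scalerAr scalerA anticomm_prod scalerA.
  rewrite (_ : count (fun j => _ && _) r = count [in S] r); last first.
    apply: eq_in_count => j jr; have [ji|] := eqVneq j i; last by rewrite andbT.
    by rewrite -ji jr in ir.
  congr (_ *: _).
  move: (count [in S] r) (count _ r) => k l.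
  rewrite !add1n binS bin1 -!exprD -[LHS]signr_odd -[RHS]signr_odd !oddD !oddb.
  congr (_ ^+ _).
  by case: (i \in M) (odd l) (odd _) (odd _) => [] [] [] [].
have cardE (T : {set 'I_n}) : #|T| = count [in T] (index_enum 'I_n).
  by rewrite cardE size_filter.
by rewrite !cardE; apply/fprod/index_enum_uniq.
Qed.

End AnticommutingFamily.

(** * Square roots, signs and gamma matrices *)

Lemma adjoin_sqrt (K : fieldType) (a : K) :
  exists (L : fieldType) (iota : {rmorphism K -> L}) (y : L), y ^+ 2 = iota a.
Proof.
have [[y ya]|no_root] := pselect (exists y, y ^+ 2 = a).
  by exists K, idfun, y.
have sz : size ('X^2 - a%:P) = 3%N by rewrite size_XnsubC.
(* A quadratic polynomial without a root is irreducible, so a root can be adjoined. *)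
have [|L _ [z rz _]] := @irredp_FAdjoin K ('X^2 - a%:P).
  apply: cubic_irreducible => [|x]; rewrite ?sz //; apply/negP=> /rootP.
  by rewrite !hornerE => /subr0_eq xa; apply: no_root; exists x.
exists L, (in_alg L), z; apply/eqP; rewrite -subr_eq0.
by move: rz; rewrite rmorphB /= map_polyXn map_polyC /root !hornerE.
Qed.

Lemma adjoin_sqrts (K : fieldType) (s : seq K) :
  exists (L : fieldType) (iota : {rmorphism K -> L}),
    forall a, a \in s -> exists y : L, y ^+ 2 = iota a.
Proof.
elim: s => [|a s [L [iota Hs]]]; first by exists K, idfun.
have [M [j [y ya]]] := adjoin_sqrt (iota a).
exists M, (j \o iota) => b; rewrite inE => /predU1P[->|/Hs[z zb]].
  by exists y.
by exists (j z); rewrite -rmorphXn zb.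
Qed.

(** Both sides change sign under [k -> k + 2]. The right side is a combination of powers, hence
    suited to sums over subsets that factor into products. *)
Lemma sign_bin2 (R : comPzRingType) (z : R) k : z * z = -1 ->
  2 * (-1) ^+ 'C(k, 2) = (1 - z) * z ^+ k + (1 + z) * (- z) ^+ k.
Proof.
move=> zz; elim/ltn_ind: k => -[|[|k]] IHk; rewrite ?bin0n ?bin1.
- by rewrite !expr0; ring.
- by rewrite !expr1 expr0; ring: zz.
have -> : 'C(k.+2, 2) = ('C(k, 2) + k.*2).+1.
  by rewrite !binS !bin1 !bin0 -addnn; lia.
rewrite exprS exprD -(signr_odd _ k.*2) odd_double expr0 mulr1 mulrCA IHk //.
by rewrite !exprS; ring: zz.
Qed.

(* With z = i, summing sign_bin2 over S factors as
   prod_j (1 + eps_j z), and (1 + z)^2 = 2 z, 1 - z = - z (1 + z). *)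
Lemma sum_signs (n : nat) (M : {set 'I_n}) : ~~ odd n ->
  \sum_(S : {set 'I_n}) (-1) ^+ ('C(#|S|, 2) + #|S :&: M|)
  = (-1) ^+ 'C(n./2 + 3 * #|M|, 2) * 2 ^+ n./2 :> int.
Proof.
move=> n_even; apply: (@intr_inj algC).
rewrite rmorphM rmorphXn rmorphN rmorph1 /= [in LHS]rmorph_sum /=.
under eq_bigr do rewrite rmorphXn rmorphN rmorph1 /=.
have prodE (z : algC) (S : {set 'I_n}) :
    \prod_j (if j \in S then (-1) ^+ (j \in M) * z else 1)
    = z ^+ #|S| * (-1) ^+ #|S :&: M|.
  rewrite -big_mkcond big_split /= prodr_const mulrC; congr (_ * _).
  rewrite -prodr_const big_mkcond [RHS]big_mkcond; apply: eq_bigr => j _ /=.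
  by rewrite inE; case: (j \in S); case: (j \in M).
have sumE (z : algC) : z * z = -1 ->
    \sum_(S : {set 'I_n}) z ^+ #|S| * (-1) ^+ #|S :&: M|
    = 2 ^+ n./2 * z ^+ (n./2 + 3 * #|M|).
  move=> zz; under eq_bigr do rewrite -prodE.
  transitivity (\prod_(j : 'I_n) ((-1) ^+ (j \in M) * z + 1)).
    by rewrite bigA_distr; apply: eq_bigl => S; rewrite inE.
  transitivity (\prod_(j : 'I_n) ((1 + z) * (if j \in M then - z else 1))).
    apply: eq_bigr => j _; case: (j \in M); rewrite ?expr1 ?expr0; ring: zz.
  rewrite big_split prodr_const card_ord -big_mkcond prodr_const /=.
  have -> : (1 + z) ^+ n = (2 * z) ^+ n./2.
    rewrite -{1}(odd_double_half n) (negPf n_even) add0n -mul2n exprM.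
    by congr (_ ^+ _); ring: zz.
  (* The 3 in the exponent comes from [- z = z ^+ 3]. *)
  rewrite exprMn exprD exprM mulrA; congr (_ * _ ^+ _).
  by rewrite !exprS expr0; ring: zz.
have ii : 'i * 'i = -1 :> algC by rewrite -expr2 Num.Theory.sqrCi.
have ii' : (- 'i) * (- 'i) = -1 :> algC by rewrite mulrNN.
(* After doubling, [sign_bin2] turns both sides into combinations of values at ['i] and [- 'i],
   which [sumE] matches term by term. *)
apply: (mulfI (_ : (2 : algC) != 0)); first by rewrite Num.Theory.pnatr_eq0.
rewrite mulr_sumr mulrA (sign_bin2 _ ii).
under eq_bigr do rewrite exprD mulrA (sign_bin2 _ ii) mulrDl -!mulrA.
rewrite big_split -!mulr_sumr /= !sumE //.
rewrite [(2 ^+ _)%:~R]rmorphXn /= [RHS]mulrDl -!mulrA.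
by congr (_ * _ + _ * _); rewrite mulrC.
Qed.

(** Doubling: the old matrices become [diag(G, -G)], and the two new ones are antidiagonal with
    blocks [1] and [1] or [-1]. Even indices give symmetric matrices of square 1, odd ones
    antisymmetric matrices of square -1. *)
Lemma gamma_matrices (L : fieldType) m :
  exists N (G : nat -> 'M[L]_N.+1), [/\ N.+1 = (2 ^ m)%N,
    forall i, (i < m.*2)%N -> G i * G i = ((-1) ^+ i)%:A,
    forall i, (i < m.*2)%N -> (G i)^T = (-1) ^+ i *: G i
  & forall i j, (i < m.*2)%N -> (j < m.*2)%N -> i != j ->
      G i * G j = - (G j * G i)].
Proof.
elim: m => [|m [N [G [N2 Gsqr Gtr Ganti]]]]; first by exists 0, (fun _ => 0).
pose e (b : bool) : 'M[L]_(N.+1 + N.+1) := block_mx 0 1 ((-1) ^+ b)%:A 0.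
pose H i : 'M[L]_(N.+1 + N.+1) :=
  if (i < m.*2)%N then block_mx (G i) 0 0 (- G i) else e (odd i).
exists (N + N.+1)%N, H.
have Hlt i : (i < m.*2)%N -> H i = block_mx (G i) 0 0 (- G i).
  by rewrite /H => ->.
have He i : (m.*2 <= i)%N -> H i = e (odd i) by rewrite /H leqNgt => /negPf->.
pose simp := (mulr0, mul0r, mulNr, mulrN, opprK, oppr0, add0r, addr0).
have mulB (A B C D A' B' C' D' : 'M[L]_N.+1) :
    (block_mx A B C D : 'M[L]_((N + N.+1).+1)) * block_mx A' B' C' D' =
    block_mx (A * A' + B * C') (A * B' + B * D')
      (C * A' + D * C') (C * B' + D * D').
  by exact: (mulmx_block A B C D A' B' C' D').
have scE (c : L) : c%:A = block_mx c%:A 0 0 c%:A :> 'M[L]_(N.+1 + N.+1).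
  have -> : c%:A = c%:M :> 'M[L]_N.+1 by apply: scalemx1.
  exact: etrans (scalemx1 _ _) (scalar_mx_block _ _ _).
have oppB (A B C D : 'M[L]_N.+1) :
    - (block_mx A B C D : 'M[L]_((N + N.+1).+1)) =
    block_mx (- A) (- B) (- C) (- D) by exact: (opp_block_mx A B C D).
have trB (A B C D : 'M[L]_N.+1) :
    (block_mx A B C D : 'M[L]_((N + N.+1).+1))^T =
    block_mx A^T C^T B^T D^T by exact: (tr_block_mx A B C D).
have scB c (A B C D : 'M[L]_N.+1) :
    c *: (block_mx A B C D : 'M[L]_((N + N.+1).+1)) =
    block_mx (c *: A) (c *: B) (c *: C) (c *: D).
  by exact: (scale_block_mx c A B C D).
split=> [|i _|i _|i j lt_i lt_j ij].
- by rewrite expnS -N2 mul2n -addnn addSn.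
- have [lt_i|le_i] := ltnP i m.*2.
    by rewrite Hlt // mulB !simp Gsqr // -scE.
  rewrite He // mulB !simp mul1r mulr1 -[in RHS]signr_odd.
  by rewrite [RHS]scE.
- have [lt_i|le_i] := ltnP i m.*2.
    by rewrite Hlt // trB scB !trmx0 !scaler0 linearN /= Gtr // scalerN.
  rewrite He // -signr_odd /e trB scB !trmx0 trmx1 !scaler0 linearZ /= trmx1.
  by rewrite scalerA -expr2 sqrr_sign scale1r.
have [lt_im|le_mi] := ltnP i m.*2; have [lt_jm|le_mj] := ltnP j m.*2.
- rewrite !Hlt // !mulB !simp oppB !simp.
  by rewrite Ganti.
- rewrite Hlt // He // !mulB !simp oppB !simp.
  by rewrite mulr_algl mulr_algr mul1r mulr1.
- rewrite (Hlt j) // He // !mulB !simp oppB !simp.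
  by rewrite mulr_algl mulr_algr mul1r mulr1.
(* Only two indices are new, so distinct ones have opposite parity. *)
have [] : odd i = ~~ odd j.
  rewrite doubleS !ltnS in lt_i lt_j; lia.
rewrite !He // !mulB !simp oppB !simp.
by move=> ->; case: (odd j); rewrite !expr1 !expr0 !mulr1 !mul1r
  !scaleN1r !scale1r ?opprK.
Qed.

(** * The trace of an adjoint involution *)

(** [P] conjugates [M] to a diagonal matrix. Its two dimensions are equal but not convertible, so a
    left and a right inverse are taken and identified. *)
Lemma trace_eigenbasis (F : fieldType) (I : finType) p (P : 'M[F]_(#|I|, p))
    (M : 'M[F]_p) (s : I -> F) :
  row_free P -> row_full P ->
  (forall k, row k P *m M = s (enum_val k) *: row k P) ->
  \tr M = \sum_i s i.
Proof.
move=> /row_freeP[R PR] /row_fullP[Q QP] eigP.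
have eqQR : Q = R by rewrite -[Q]mulmx1 -PR mulmxA QP mul1mx.
have PM : P *m M = diag_mx (\row_k s (enum_val k)) *m P.
  by apply/row_matrixP=> k; rewrite row_mul eigP;
    apply/rowP=> l; rewrite mul_diag_mx !mxE.
rewrite -[M]mul1mx -QP -mulmxA PM mxtrace_mulC -mulmxA eqQR PR mulmx1.
rewrite mxtrace_diag [RHS](reindex_onto enum_val enum_rank) /=; last first.
  by move=> i _; rewrite enum_rankK.
by apply: eq_big => [k|k _]; rewrite ?enum_valK ?eqxx ?mxE.
Qed.

(** The coefficient of [B^-1 E_ji B] at [E_ij] is the product of the [(i, j)] entries of [B^-1] and
    [B]; these sum to the trace of [B^-1 B^T]. *)
Lemma trace_adjoint (F : fieldType) N (B : 'M[F]_N) (d : F) :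
  B \in unitmx -> B^T = d *: B ->
  \tr (lin_mx (mulmxr B \o (mulmx (invmx B) \o trmx))) = d * N%:R.
Proof.
move=> uB trB; transitivity (\tr (invmx B *m B^T)); last first.
  by rewrite trB -scalemxAr mulVmx // mxtraceZ mxtrace1.
transitivity (\sum_i \sum_j invmx B i j * B^T j i); last first.
  by apply: eq_bigr => i _; rewrite mxE.
rewrite /mxtrace (reindex _ (curry_mxvec_bij _ _)) pair_big /=.
apply: eq_bigr => -[i j] _ /=.
rewrite !mxE /= vec_mx_delta mxvecE trmx_delta.
rewrite -(mul_delta_mx (0 : 'I_1)) mulmxA.
by rewrite -colE -mulmxA -rowE !mxE big_ord1 !mxE.
Qed.

(** The last hypothesis reads [B^-1 X_i^T B = s_i X_i]: the [X i] are an eigenbasis for the map of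
    [trace_adjoint]. Counting it gives the second conjunct. *)
Lemma adjoint_trace (F : fieldType) (I : finType) N (X : I -> 'M[F]_N)
    (s : I -> F) (B : 'M[F]_N) (d : F) :
  (forall Y, exists c : I -> F, Y = \sum_i c i *: X i) ->
  (forall c : I -> F, \sum_i c i *: X i = 0 -> forall i, c i = 0) ->
  B \in unitmx -> B^T = d *: B ->
  (forall i, (X i)^T *m B = s i *: (B *m X i)) ->
  d * N%:R = \sum_i s i /\ (N * N)%N = #|I|.
Proof.
move=> genX freeX uB trB adjX.
pose P : 'M[F]_(#|I|, N * N) := \matrix_k mxvec (X (enum_val k)).
have mulP (v : 'rV_#|I|) : v *m P = mxvec (\sum_i v 0 (enum_rank i) *: X i).
  rewrite mulmx_sum_row linear_sum (reindex enum_rank) /=; last first.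
    by apply: onW_bij; apply: enum_rank_bij.
  by apply: eq_bigr => i _; rewrite rowK enum_rankK linearZ.
have freeP : row_free P.
  apply: inj_row_free => v; rewrite mulP => /(canRL mxvecK).
  rewrite linear0 => /freeX v0; apply/rowP=> k.
  by rewrite -[k]enum_valK v0 mxE.
have fullP : row_full P.
  rewrite -sub1mx; apply/row_subP=> k.
  have [c cE] := genX (vec_mx (row k 1%:M)).
  apply/submxP; exists (\row_k c (enum_val k)).
  rewrite mulP -[LHS]vec_mxK cE; congr (mxvec _).
  by apply: eq_bigr => i _; rewrite mxE enum_rankK.
split; last exact: etrans (esym (eqP fullP)) (eqP freeP).
rewrite -(trace_adjoint uB trB); apply: (trace_eigenbasis freeP fullP) => k.
rewrite !rowK mul_vec_lin /= -linearZ /=; congr (mxvec _).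
by rewrite -mulmxA adjX -scalemxAr mulKmx.
Qed.

(** * Clifford algebras *)

Section RestrictScalars.
Variables (K L : fieldType) (iota : {rmorphism K -> L}) (A : algType L).

(* The morphism argument is a phantom: it selects the K-algebra structure. *)
Definition restrict_scalars of {rmorphism K -> L} : Type := A.
Local Notation rA := (restrict_scalars iota).

HB.instance Definition _ := GRing.NzRing.on rA.

Definition restrict_scale (c : K) (x : rA) : rA := iota c *: (x : A).

Fact restrict_scaleA a b x :
  restrict_scale a (restrict_scale b x) = restrict_scale (a * b) x.
Proof. by rewrite /restrict_scale scalerA rmorphM. Qed.

Fact restrict_scale1 : left_id 1 restrict_scale.
Proof. by move=> x; rewrite /restrict_scale rmorph1 scale1r. Qed.

Fact restrict_scaleDr : right_distributive restrict_scale +%R.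
Proof. by move=> c x y; apply: scalerDr. Qed.

Fact restrict_scaleDl x : {morph restrict_scale^~ x : a b / a + b}.
Proof. by move=> a b; rewrite /restrict_scale rmorphD; apply: scalerDl. Qed.

HB.instance Definition _ := GRing.Zmodule_isLmodule.Build K rA
  restrict_scaleA restrict_scale1 restrict_scaleDr restrict_scaleDl.

Fact restrict_scaleAl (c : K) (x y : rA) : c *: (x * y) = (c *: x) * y.
Proof. exact: (@scalerAl L A). Qed.

HB.instance Definition _ := GRing.Lmodule_isLalgebra.Build K rA
  restrict_scaleAl.

Fact restrict_scaleAr (c : K) (x y : rA) : c *: (x * y) = x * (c *: y).
Proof. exact: (@scalerAr L A). Qed.

HB.instance Definition _ := GRing.Lalgebra_isAlgebra.Build K rA
  restrict_scaleAr.

(** The universal property is applied over [K] to the target with restricted scalars, and the lift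
    is then read as a semilinear map into [A]. *)
Lemma clifford_lift_semilinear (V : vectType K) (q : quadratic_form V)
    (f : {linear V -> A | iota \; *:%R}) :
  (forall v, f v * f v = (iota (q v))%:A) ->
  exists phi : {lrmorphism clifford q -> A | iota \; *:%R},
    forall v, phi (clifford_in q v) = f v.
Proof.
move=> fq; pose f0 : V -> rA := f.
have f0L : linear f0 by move=> a u v; rewrite /f0 linearP.
pose f' := HB.pack_for {linear V -> rA} f0
  (GRing.isLinear.Build K V rA *:%R f0 f0L).
have f'q v : f' v * f' v = (q v)%:A by apply: fq.
pose p := clifford_lift f'q.
pose p0 : clifford q -> A := p.
have p0L : linear_for (iota \; *:%R) p0 by move=> a u v; rewrite /p0 linearP.
have p0M : monoid_morphism p0 by split=> [|x y]; rewrite /p0 ?rmorph1 ?rmorphM.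
exists (HB.pack_for {lrmorphism clifford q -> A | iota \; *:%R} p0
  (GRing.isLinear.Build K (clifford q) A (iota \; *:%R) p0 p0L)
  (GRing.isMonoidMorphism.Build (clifford q) A p0 p0M)) => v.
exact: (clifford_lift_in f'q v).
Qed.

End RestrictScalars.

Section CliffordInduction.
Variables (K : fieldType) (V : vectType K) (q : quadratic_form V).

(** Every element comes from the free algebra through two quotients; there it is a combination of
    words, which are peeled from the left. *)
Lemma clifford_ind (P : clifford q -> Prop) :
  P 0 -> P 1 -> (forall a x y, P x -> P y -> P (a *: x + y)) ->
  (forall v x, P x -> P (clifford_in q v * x)) -> forall x, P x.
Proof.
move=> P0 P1 PL PM x; rewrite -[x]quot_reprK -[quot_repr x]quot_reprK.
move: (quot_repr (quot_repr x)) => {x} z.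
pose pi (y : free_alg K V) : clifford q := quot_pi _ (quot_pi _ y).
rewrite -/(pi z).
have piZ a y : pi (a *: y) = a *: pi y by rewrite /pi !linearZ.
have piD y y' : pi (y + y') = pi y + pi y' by rewrite /pi !raddfD.
have piM y y' : pi (y * y') = pi y * pi y' by rewrite /pi !rmorphM.
rewrite [z]monalgE; apply: (big_ind (fun y => P (pi y))) => [|y y' Py Py'|w _].
- by rewrite /pi !raddf0.
- by rewrite piD -[pi y]scale1r; apply: PL.
have -> : << z@_w *g w >> = z@_w *: << w >> :> free_alg K V.
  by apply/malgP=> k; rewrite mcoeffZ !mcoeffU mulrnAr mulr1.
rewrite piZ -[_ *: _]addr0; apply: PL => //.
case: w => s; elim: s => [|v s IHs].
  have -> : << FMonom [::] >> = 1 :> free_alg K V.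
    by congr (<< _ >>); apply/val_inj; rewrite /= fm1.
  by rewrite /pi !rmorph1.
have -> : << FMonom (v :: s) >> = free_gen K v * << FMonom s >> :> free_alg K V.
  rewrite [RHS]fgmulUU mulr1; congr (<< _ >>); apply/val_inj.
  by rewrite /= fmM fmU.
by rewrite piM; apply: PM.
Qed.

End CliffordInduction.

(** * Orthogonal bases of eigenvectors *)

Section OrthogonalBasis.
Variables (K : fieldType) (V : vectType K) (q : quadratic_form V).
Hypothesis K2 : (2 : K) != 0.

Lemma bqC x y : bq q x y = bq q y x.
Proof. by rewrite /bq [x + y]addrC addrAC. Qed.

Lemma bq_linear y : scalar (bq q ^~ y).
Proof. by move=> a x x'; rewrite /bq qf_polar mulrDr mulrCA. Qed.

Lemma bq0l y : bq q 0 y = 0.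
Proof. by rewrite /bq add0r qf0 subr0 subrr mulr0. Qed.

Lemma bqDl x x' y : bq q (x + x') y = bq q x y + bq q x' y.
Proof. by rewrite -{1}[x]scale1r bq_linear mul1r. Qed.

Lemma bqZl a x y : bq q (a *: x) y = a * bq q x y.
Proof. by rewrite -[a *: x]addr0 bq_linear bq0l addr0. Qed.

Lemma bqBl x x' y : bq q (x - x') y = bq q x y - bq q x' y.
Proof. by rewrite -scaleN1r bqDl bqZl mulN1r. Qed.

Lemma qfD x y : q (x + y) = q x + q y + 2 * bq q x y.
Proof. by rewrite /bq mulrA divff // mul1r; ring. Qed.

(** If [q] vanishes on [U], polarization makes any basis orthogonal; otherwise a vector with
    [q x != 0] splits off. Subspaces are allowed so that both eigenspaces of [sigma] are covered. *)
Lemma orthogonal_basis (U : {vspace V}) :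
  exists2 X : seq V, basis_of U X & pairwise (fun x y => bq q x y == 0) X.
Proof.
have [d] := ubnP (\dim U); elim: d U => // d IHd U dU.
have [q0|/existsNP[x /not_implyP[Ux /eqP qx]]] :=
    pselect (forall x, x \in U -> q x = 0).
  exists (vbasis U); first exact: vbasisP.
  apply/(pairwiseP 0) => i j lti ltj _; apply/eqP.
  have Ub k : k \in gtn (size (vbasis U)) -> (vbasis U)`_k \in U.
    by move=> ltk; apply: vbasis_mem; apply: mem_nth.
  apply: (mulfI K2); rewrite mulr0 -[RHS](q0 ((vbasis U)`_i + (vbasis U)`_j)).
    by rewrite qfD !q0 ?Ub // !add0r.
  by rewrite memvD ?Ub.
pose b0 : V -> K^o := bq q ^~ x.
pose b := linfun (HB.pack_for {linear V -> K^o} b0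
  (GRing.isLinear.Build K V K^o *:%R b0 (bq_linear x))).
have bE y : b y = bq q y x by rewrite lfunE.
pose W := (U :&: lker b)%VS.
have memW y : (y \in W) = (y \in U) && (bq q y x == 0).
  by rewrite memv_cap memv_ker bE.
have xW : x \notin W by rewrite memW Ux bqxx.
have defU : (<[x]> + W)%VS = U.
  apply/eqP; rewrite eqEsubv subv_add capvSl -memvE Ux /=.
  apply/subvP=> y Uy; rewrite -[y](subrKC (bq q y x / q x *: x)).
  apply: memv_add; first by rewrite memvZ ?memv_line.
  by rewrite memW memvB ?memvZ //= bqBl bqZl bqxx // divfK ?subrr.
have dW : (\dim W < d)%N.
  apply: (@leq_trans (\dim U)) => //; rewrite ltn_neqAle dimvS ?capvSl // andbT.
  apply: contraNneq xW => dimW; suff -> : W = U by [].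
  by apply/eqP; rewrite eqEdim capvSl dimW /=.
have [X basX orthX] := IHd W dW; exists (x :: X).
  by rewrite /basis_of span_cons free_cons (span_basis basX) defU eqxx xW
    (basis_free basX).
rewrite /= orthX andbT; apply/allP=> y /(basis_mem basX).
by rewrite memW bqC => /andP[].
Qed.

(** As 2 is invertible, [V] is the direct sum of the eigenspaces for -1 and 1. They are orthogonal
    because [sigma] is an isometry, so orthogonal bases of the two can be concatenated. *)
Lemma orthogonal_eigenbasis (sigma : 'End(V)) :
  nondegenerate_qf q -> orthogonal_symmetry q sigma ->
  exists (e : (\dim {:V}).-tuple V) (M : {set 'I_(\dim {:V})}),
  [/\ basis_of {:V} e,
      forall i j : 'I_(\dim {:V}), i != j -> bq q e`_i e`_j = 0,
      forall i : 'I_(\dim {:V}), q e`_i != 0,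
      forall i : 'I_(\dim {:V}), sigma e`_i = (-1) ^+ (i \in M) *: e`_i
    & #|M| = \dim (minus_space sigma)].
Proof.
move=> q_nondeg [isom sK].
pose Vp := lker (sigma - \1)%VF; set Vm := minus_space sigma.
have memVp x : reflect (sigma x = x) (x \in Vp).
  rewrite memv_ker !lfun_simp subr_eq0; exact: eqP.
have two_eq0 (x : V) : x + x = 0 -> x = 0.
  move/eqP; rewrite -mulr2n -scaler_nat scaler_eq0 (negPf K2) => /eqP//.
have defV : (Vm + Vp)%VS = {:V}%VS.
  apply/eqP; rewrite eqEsubv subvf; apply/subvP=> x _.
  have -> : x = 2^-1 *: (x - sigma x) + 2^-1 *: (x + sigma x).
    rewrite -scalerDr addrACA addNr addr0 -mulr2n -scaler_nat scalerA.
    by rewrite mulVf ?scale1r.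
  apply: memv_add; rewrite memvZ //.
    by apply/minus_spaceP; rewrite linearB /= sK opprB.
  by apply/memVp; rewrite linearD /= sK addrC.
have dir : directv (Vm + Vp).
  apply/directv_addP/eqP; rewrite -subv0; apply/subvP=> x.
  rewrite memv_cap memv0 => /andP[/minus_spaceP xm /memVp xp].
  by apply/eqP/two_eq0; rewrite -{1}xp xm addNr.
have szB (U : {vspace V}) X : basis_of U X -> size X = \dim U.
  by case/andP=> /eqP<- /eqnP.
have [Xm bm om] := orthogonal_basis Vm.
have [Xp bp op] := orthogonal_basis Vp.
have := cat_basis dir bm bp; rewrite defV => basX.
have szX : size (Xm ++ Xp) == \dim {:V} by rewrite (szB _ _ basX).
pose e : (\dim {:V}).-tuple V := Tuple szX.
pose M := [set i : 'I_(\dim {:V}) | (i < size Xm)%N].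
have orthX : pairwise (fun x y => bq q x y == 0) e.
  rewrite pairwise_cat om op !andbT; apply/allrelP=> x y.
  move=> /(basis_mem bm)/minus_spaceP xm /(basis_mem bp)/memVp yp.
  have := isom x y; rewrite xm yp -scaleN1r bqZl mulN1r => /eqP.
  rewrite eq_sym -addr_eq0 -mulr2n -mulr_natl mulf_eq0 (negPf K2) /=.
  by move/eqP->.
have orth (i j : 'I_(\dim {:V})) : i != j -> bq q e`_i e`_j = 0.
  have lt (k l : 'I_(\dim {:V})) : (k < l)%N -> bq q e`_k e`_l = 0.
    move=> ltkl; move/(pairwiseP 0): orthX => /(_ k l).
    by rewrite !inE !size_tuple !ltn_ord => /(_ isT isT ltkl)/eqP.
  by rewrite neq_ltn => /orP[/lt//|/lt]; rewrite bqC.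
exists e, M; split=> // [i|i|].
(* A basis vector with [q e_i = 0] would be orthogonal to the whole basis, against nondegeneracy. *)
- apply/eqP=> qi0; have /negP[] := basis_not0 basX (mem_tnth i e).
  rewrite (tnth_nth 0); apply/eqP/q_nondeg => y.
  have -> : y = \sum_j coord e j y *: e`_j.
    exact: (coord_basis (basX : basis_of _ e)) (memvf y).
  rewrite bqC.
  elim/big_ind: _ => [|u v u0 v0|j _]; rewrite ?bq0l ?bqDl ?u0 ?v0 ?addr0 //.
  by rewrite bqZl; have [->|/orth->] := eqVneq j i; rewrite ?bqxx ?qi0 ?mulr0.
- have := mem_tnth i e; rewrite (tnth_nth 0) inE /= nth_cat.
  case: ltnP => [lti _|gei]; first rewrite expr1 scaleN1r.
    exact/minus_spaceP/(basis_mem bm)/mem_nth.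
  have szi : (i - size Xm < size Xp)%N.
    by rewrite ltn_subLR // -size_cat (eqP szX).
  by rewrite expr0 scale1r => _; apply/memVp/(basis_mem bp)/mem_nth.
have les : (size Xm <= \dim {:V})%N by rewrite -(eqP szX) size_cat leq_addr.
rewrite -(szB _ _ bm) cardsE -sum1_card -(big_ord_widen _ (fun=> 1%N) les).
by rewrite sum1_card card_ord.
Qed.

End OrthogonalBasis.

(** * Ordered products of the orthogonal generators *)

Section CliffordBasis.
Variables (K : fieldType) (V : vectType K) (q : quadratic_form V) (n : nat).
Variables (e : n.-tuple V).
Hypothesis K2 : (2 : K) != 0.
Hypothesis n_even : ~~ odd n.
Hypothesis e_basis : basis_of {:V} e.
Hypothesis e_orth : forall i j : 'I_n, i != j -> bq q e`_i e`_j = 0.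
Hypothesis e_neq0 : forall i : 'I_n, q e`_i != 0.

Definition cgen (i : 'I_n) : clifford q := clifford_in q e`_i.

Lemma cgen_sqr i : cgen i * cgen i = (q e`_i)%:A.
Proof. exact: clifford_in_sqr. Qed.

Lemma cgen_anti i j : i != j -> cgen i * cgen j = - (cgen j * cgen i).
Proof.
(* By orthogonality the square of the sum is [q e_i + q e_j], so the cross terms cancel. *)
move=> ij; have := clifford_in_sqr q (e`_i + e`_j).
rewrite qfD // e_orth // mulr0 addr0 scalerDl linearD /= mulrDl !mulrDr.
rewrite -!cgen_sqr -!/(cgen _) -addrA => /addrI.
by rewrite addrA -[RHS]add0r => /addIr/eqP; rewrite addr_eq0 => /eqP.
Qed.

Lemma clifford_in_cgen v : clifford_in q v = \sum_i coord e i v *: cgen i.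
Proof.
rewrite {1}(coord_basis e_basis (memvf v)) linear_sum.
by apply: eq_bigr => i _; rewrite linearZ.
Qed.

Lemma cgen_ind (P : clifford q -> Prop) :
  P 0 -> P 1 -> (forall a x y, P x -> P y -> P (a *: x + y)) ->
  (forall i x, P x -> P (cgen i * x)) -> forall x, P x.
Proof.
move=> P0 P1 PL PM; apply: clifford_ind => // v x Px.
rewrite clifford_in_cgen mulr_suml.
apply: (big_ind P) => [|y z Py Pz|i _] //.
  by rewrite -[y]scale1r; apply: PL.
by rewrite -scalerAl -[_ *: _]addr0; apply: PL => //; apply: PM.
Qed.

(** The span of the products contains 1 and, by [gprod_mull], is stable under left multiplication by
    generators. *)
Lemma cgen_span x : exists c : {set 'I_n} -> K, x = \sum_S c S *: gprod cgen S.
Proof.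
elim/cgen_ind: x => [||a x y [c ->] [d ->]|i x [c ->]].
- by exists (fun=> 0); rewrite big1 // => S _; rewrite scale0r.
- exists (fun S => (S == set0)%:R); rewrite (bigD1 set0) //= eqxx scale1r.
  rewrite [X in _ + X]big1 ?addr0 => [|S /negPf->]; last by rewrite scale0r.
  by rewrite /gprod big_set0.
- exists (fun S => a * c S + d S); rewrite scaler_sumr -big_split.
  by apply: eq_bigr => S _ /=; rewrite scalerA -scalerDl.
have /choice[f /choice[b bE]] : forall S, exists T b,
    cgen i * gprod cgen S = b *: gprod cgen T.
  by move=> S; have [b [T bT]] := gprod_mull cgen_sqr cgen_anti i S;
    exists T, b.
exists (fun T => \sum_(S | f S == T) c S * b S).
transitivity (\sum_T \sum_(S | f S == T) (c S * b S) *: gprod cgen T).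
  rewrite (exchange_big_dep xpredT) //= mulr_sumr; apply: eq_bigr => S _.
  rewrite (big_pred1 (f S)) => [|T]; last by rewrite eq_sym.
  by rewrite -scalerAr bE scalerA.
by apply: eq_bigr => T _; rewrite scaler_suml.
Qed.

Lemma cgen_involution (J : clifford q -> clifford q) (sigma : 'End(V))
    (M S : {set 'I_n}) :
  is_clifford_involution sigma J ->
  (forall i : 'I_n, sigma e`_i = (-1) ^+ (i \in M) *: e`_i) ->
  J (gprod cgen S) = (-1) ^+ ('C(#|S|, 2) + #|S :&: M|) *: gprod cgen S.
Proof.
move=> [[JL J1 JM _] Jin] se; apply: (gprod_antimorph cgen_anti) => // i.
by rewrite Jin se linearZ.
Qed.

(** * Splittings and the sign of the adjoint form *)

Section Splitting.
Variables (L : fieldType) (iota : {rmorphism K -> L}) (m : nat).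
Variable phi : {lrmorphism clifford q -> 'M[L]_m.+1 | iota \; *:%R}.

Lemma splittingZ c x : phi (c *: x) = iota c *: phi x.
Proof. exact: (linearZ_LR phi). Qed.

Lemma splittingD x y : phi (x + y) = phi x + phi y.
Proof. exact: raddfD. Qed.

Lemma splittingM x y : phi (x * y) = phi x * phi y.
Proof. exact: rmorphM. Qed.

Definition sgen i : 'M[L]_m.+1 := phi (cgen i).

Lemma sgen_sqr i : sgen i * sgen i = (iota (q e`_i))%:A.
Proof. by rewrite /sgen -splittingM cgen_sqr splittingZ rmorph1. Qed.

Lemma sgen_anti i j : i != j -> sgen i * sgen j = - (sgen j * sgen i).
Proof. by move=> ij; rewrite /sgen -!splittingM cgen_anti // raddfN. Qed.

Lemma splitting_gprod S : phi (gprod cgen S) = gprod sgen S.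
Proof. by rewrite rmorph_prod. Qed.

(** The images of the generators satisfy the same relations over [L], with nonzero squares, so
    independence holds over [L] and not only over [K]. *)
Lemma sgen_indep (c : {set 'I_n} -> L) :
  \sum_S c S *: gprod sgen S = 0 -> forall S, c S = 0.
Proof.
apply: (gprod_indep sgen_sqr sgen_anti) => // [|i]; last by rewrite fmorph_eq0.
by rewrite -(rmorph_nat iota) fmorph_eq0.
Qed.

Lemma sgen_generate : is_splitting phi ->
  forall Y, exists c : {set 'I_n} -> L, Y = \sum_S c S *: gprod sgen S.
Proof.
case=> d [b [_ b_basis]] Y.
pose X := [seq phi x | x <- b].
have [c cE] := choice (fun i => cgen_span (tnth b i)).
pose bt := [tuple of X].
have YE := coord_basis (b_basis : basis_of _ bt) (memvf Y).
exists (fun S => \sum_i coord bt i Y * iota (c i S)).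
transitivity (\sum_S \sum_i (coord bt i Y * iota (c i S)) *: gprod sgen S).
  rewrite exchange_big [LHS]YE; apply: eq_bigr => i _ /=.
  rewrite -tnth_nth tnth_map [in LHS]cE raddf_sum scaler_sumr /=.
  by apply: eq_bigr => S _; rewrite splittingZ splitting_gprod scalerA.
by apply: eq_bigr => S _; rewrite scaler_suml.
Qed.

(** Computing the trace of the adjoint involution in two ways gives [d * m.+1 = \sum_S s S], and the
    dimension count gives [m.+1 = 2 ^ n./2], which is invertible in [L]. The scalar [d] is
    arbitrary, so the lemma applies to symmetric and antisymmetric [B] alike. *)
Lemma splitting_sign (J : clifford q -> clifford q) (sigma : 'End(V))
    (M : {set 'I_n}) (B : 'M[L]_m.+1) (d : L) :
  is_clifford_involution sigma J ->
  (forall i : 'I_n, sigma e`_i = (-1) ^+ (i \in M) *: e`_i) ->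
  is_splitting phi -> B \in unitmx -> B^T = d *: B ->
  (forall x, (phi (J x))^T *m B = B *m phi x) ->
  d = (-1) ^+ 'C(n./2 + 3 * #|M|, 2).
Proof.
move=> J_sigma se spl uB trB adj.
pose s (S : {set 'I_n}) : L := (-1) ^+ ('C(#|S|, 2) + #|S :&: M|).
have adjg S : (gprod sgen S)^T *m B = s S *: (B *m gprod sgen S).
  (* The adjunction is used on the right side, where the sign produced by [J] cancels [s S]. *)
  rewrite -splitting_gprod -adj (cgen_involution _ J_sigma se) splittingZ.
  rewrite [in RHS]linearZ /= -scalemxAl scalerA rmorphXn rmorphN rmorph1 /=.
  by rewrite -expr2 sqrr_sign scale1r.
have [] := adjoint_trace (sgen_generate spl) sgen_indep uB trB adjg.
rewrite -cardsT -powersetT card_powerset cardsT card_ord.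
have -> : (2 ^ n = 2 ^ n./2 * 2 ^ n./2)%N.
  by rewrite -expnD addnn -{1}(odd_double_half n) (negPf n_even).
move=> tr /eqP; rewrite !mulnn eqn_sqr => /eqP mE.
have sE : \sum_S s S = (-1) ^+ 'C(n./2 + 3 * #|M|, 2) * (2 ^ n./2)%:R.
  have := congr1 (intr : int -> L) (sum_signs M n_even).
  rewrite [LHS]rmorph_sum rmorphM rmorph_sign natrX rmorphXn /= => <-.
  by apply: eq_bigr => S _; rewrite rmorph_sign.
move: tr; rewrite mE sE => /mulIf; apply.
by rewrite natrX expf_eq0 negb_and -(rmorph_nat iota) fmorph_eq0 K2 orbT.
Qed.

(** The [2 ^ n] images of the products are independent over [L], in a matrix space of dimension
    [(2 ^ n./2) ^ 2 = 2 ^ n]. *)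
Lemma cgen_splitting : m.+1 = (2 ^ n./2)%N -> is_splitting phi.
Proof.
move=> mE; pose d := #|{set 'I_n}|.
pose b := [tuple gprod cgen (enum_val i) | i < d].
exists d, b.
have sumE (R : nmodType) (F : {set 'I_n} -> R) :
    \sum_S F S = \sum_(i < d) F (enum_val i).
  exact: (reindex _ (onW_bij _ (enum_val_bij _))).
split=> [x|].
  have [c xE] := cgen_span x.
  exists (\row_i c (enum_val i)); split=> [|c'].
    by rewrite xE sumE; apply: eq_bigr => i _; rewrite mxE tnth_mktuple.
  (* Uniqueness over [K] follows from independence of the images, since [iota] is injective. *)
  rewrite {1}xE sumE => /eqP; rewrite -subr_eq0 -sumrB => /eqP/(congr1 phi).
  rewrite raddf_sum raddf0 => c0; apply/rowP=> i; rewrite mxE.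
  have := @sgen_indep (fun S => iota (c S - c' 0 (enum_rank S))).
  rewrite sumE => /(_ _ (enum_val i)); rewrite enum_valK => h.
  apply/eqP; rewrite -subr_eq0 -(fmorph_eq0 iota) h // -[RHS]c0.
  apply: eq_bigr => j _; rewrite enum_valK tnth_mktuple -scalerBl /= splittingZ.
  by rewrite splitting_gprod.
pose X := [tuple of [seq phi x | x <- b]].
rewrite -/(tval X) basisEfree subvf size_tuple dimvf /=.
apply/andP; split; last first.
  rewrite -[dim _]/(m.+1 * m.+1)%N mE -expnD addnn.
  rewrite /d -cardsT -powersetT card_powerset cardsT card_ord.
  by rewrite -{2}(odd_double_half n) (negPf n_even).
apply/(@freeP _ _ d X) => k k0 i.
have := @sgen_indep (fun S => k (enum_rank S)).
rewrite sumE => /(_ _ (enum_val i)); rewrite enum_valK; apply.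
rewrite -[RHS]k0; apply: eq_bigr => j _; rewrite enum_valK -tnth_nth tnth_map.
by rewrite tnth_mktuple splitting_gprod.
Qed.

(** [J] and transposition both reverse products, so their composite preserves the order and checking
    generators suffices. *)
Lemma cgen_adjoint (J : clifford q -> clifford q) (sigma : 'End(V))
    (B : 'M[L]_m.+1) :
  is_clifford_involution sigma J ->
  (forall i, (phi (J (cgen i)))^T *m B = B *m phi (cgen i)) ->
  forall x, (phi (J x))^T *m B = B *m phi x.
Proof.
move=> [[JL J1 JM _] _] adj; apply: cgen_ind => [||a x y IHx IHy|i x IHx].
- have -> : J 0 = 0 by have := JL (-1) 0 0; rewrite !scaleN1r !addNr.
  by rewrite raddf0 trmx0 mul0mx mulmx0.
- by rewrite J1 rmorph1 trmx1 mul1mx mulmx1.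
- rewrite JL splittingD splittingZ (splittingD (a *: x)) (splittingZ a x).
  move: (phi (J x)) (phi (J y)) (phi x) (phi y) IHx IHy => Jx Jy fx fy IHx IHy.
  by rewrite linearP /= mulmxDl mulmxDr -scalemxAl -scalemxAr IHx IHy.
have := splittingM (cgen i) x.
have := splittingM (J x) (J (cgen i)); rewrite -JM.
move: (phi (J (_ * _))) (phi (_ * _)) => fJgx fgx -> ->.
move: (phi (J x)) (phi x) (phi (J (cgen i))) (phi (cgen i)) (adj i) IHx.
move=> Jx fx Jg fg adjg IHx.
by rewrite trmx_mul -mulmxA IHx mulmxA adjg mulmxA.
Qed.

End Splitting.

(** The sign of [B] under transposition is left open here; [splitting_sign] determines it
    afterwards. *)
Lemma clifford_symmetric_splitting (J : clifford q -> clifford q)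
    (sigma : 'End(V)) (M : {set 'I_n}) :
  is_clifford_involution sigma J ->
  (forall i : 'I_n, sigma e`_i = (-1) ^+ (i \in M) *: e`_i) ->
  exists (L : fieldType) (iota : {rmorphism K -> L}) (m : nat)
      (phi : {lrmorphism clifford q -> 'M[L]_m.+1 | iota \; *:%R})
      (B : 'M[L]_m.+1) (k : nat),
    [/\ is_splitting phi, B \in unitmx, B^T = (-1) ^+ k *: B
      & forall x, (phi (J x))^T *m B = B *m phi x].
Proof.
move=> J_sigma se.
(* The [i]-th gamma matrix has square [(-1) ^+ i]; multiplied by a root of [(-1) ^+ i * q e_i] it
   gets square [q e_i]. *)
have [L [iota rootL]] := adjoin_sqrts [seq (-1) ^+ i * q e`_i | i : 'I_n].
have /choice[c cE] (i : 'I_n) :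
    exists y : L, y ^+ 2 = (-1) ^+ i * iota (q e`_i).
  have [|y yE] := rootL ((-1) ^+ i * q e`_i); first by apply: image_f.
  by exists y; rewrite yE rmorphM rmorph_sign.
have nE : n = n./2.*2 by rewrite -{1}(odd_double_half n) (negPf n_even).
have [m [G [mE Gsqr Gtr Ganti]]] := gamma_matrices L n./2.
have lt_n (i : 'I_n) : (i < n./2.*2)%N by rewrite -nE.
exists L, iota, m.
have [g [g_sqr g_anti g_tr]] : exists g : 'I_n -> 'M[L]_m.+1,
    [/\ forall i, g i * g i = (iota (q e`_i))%:A,
        forall i j, i != j -> g i * g j = - (g j * g i)
      & forall i, (g i)^T = (-1) ^+ i *: g i].
  exists (fun i => c i *: G i); split=> [i|i j ij|i].
  - rewrite -scalerAl -scalerAr scalerA Gsqr // scalerA -expr2 cE mulrAC.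
    by rewrite -expr2 sqrr_sign mul1r.
  - by rewrite -!scalerAl -!scalerAr Ganti // !scalerN !scalerA mulrC.
  by rewrite linearZ /= Gtr // !scalerA mulrC.
pose f0 v : 'M[L]_m.+1 := \sum_i iota (coord e i v) *: g i.
have f0L : linear_for (iota \; *:%R) f0.
  move=> a u v; rewrite /f0 /= scaler_sumr -big_split; apply: eq_bigr => i _ /=.
  by rewrite linearP rmorphD rmorphM scalerDl scalerA.
pose f := HB.pack_for {linear V -> 'M[L]_m.+1 | iota \; *:%R} f0
  (GRing.isLinear.Build K V 'M[L]_m.+1 (iota \; *:%R) f0 f0L).
have [phi phiE] :
    exists phi : {lrmorphism clifford q -> 'M[L]_m.+1 | iota \; *:%R},
    forall v, phi (clifford_in q v) = f v.
  apply: clifford_lift_semilinear => v.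
  (* The terms of [f v] anticommute, so only their squares remain; [q v] reduces likewise by
     orthogonality. *)
  rewrite [f v * _]sum_anticomm_sqr => [|i j ij]; last first.
    rewrite -!scalerAl -!scalerAr g_anti // !scalerN !scalerA mulrC.
    by rewrite addNr.
  rewrite {3}(coord_basis e_basis (memvf v)) qf_sum rmorph_sum scaler_suml.
  apply: eq_bigr => i _; rewrite [X in _ + X]big1 => [|j ji].
    rewrite addr0 qfZ -scalerAl -scalerAr g_sqr !scalerA.
    by rewrite rmorphM expr2 rmorphM.
  have ij : j != i :> 'I_n by rewrite neq_ltn ji.
  rewrite qfD // bqZl bqC bqZl e_orth 1?eq_sym // !mulr0 addr0.
  by ring.
have phi_gen i : phi (cgen i) = g i.
  have freee := basis_free e_basis.
  rewrite phiE /= /f0 (bigD1 i) //= big1 => [|j ji].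
    by rewrite coord_free // eqxx rmorph1 scale1r addr0.
  by rewrite coord_free // eq_sym (negPf ji) rmorph0 scale0r.
exists phi.
(* g_i^T = (-1)^i g_i, so B must commute with g_i exactly when i and [i \in M]
   have the same parity. *)
pose P := [set i : 'I_n | odd i (+) (i \in M)].
have [S PS] := odd_cardsD1_surj P n_even.
pose B := gprod g S; exists B.
pose O := [set i : 'I_n | odd i].
(* This is the exponent of [gprod_antimorph] for transposition, [O] being the set of antisymmetric
   generators. *)
exists ('C(#|S|, 2) + #|S :&: O|)%N.
split.
- exact: cgen_splitting.
- have [|x xB] := gprod_lunit g_sqr S; first by move=> i; rewrite fmorph_eq0.
  by have [] := mulmx1_unit xB.
- apply: (gprod_antimorph g_anti) => [|||i].
  + exact: linearP.
  + exact: trmx1.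
  + exact: trmx_mul.
  by rewrite g_tr inE signr_odd.
apply: (cgen_adjoint J_sigma) => i.
have [_ Jin] := J_sigma.
rewrite {1}/cgen Jin se linearZ splittingZ -/(cgen i) phi_gen rmorph_sign.
rewrite linearZ /= g_tr scalerA.
rewrite -scalemxAl [g i *m B](gprod_comm g_anti) scalerA.
rewrite -(signr_odd _ #|S :\ i|) PS inE -(signr_odd _ i).
by rewrite -!signr_addb; case: (odd i) (i \in M) => [] []; rewrite scale1r.
Qed.

End CliffordBasis.

(** * The congruence modulo 8 *)

Lemma odd_bin2 k : odd 'C(k, 2) = (1 < k %% 4)%N.
Proof.
elim/ltn_ind: k => -[|[|[|[|k]]]] IHk //.
(* The increment [4 k + 6] is even, so the parity has period 4. *)
have -> : 'C(k.+4, 2) = ('C(k, 2) + (k + 1).*2.*2 + 2)%N.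
  by rewrite !binS !bin1 !bin0; lia.
rewrite !oddD !odd_double /= !addbF IHk; last by lia.
by rewrite -[k.+4]addn4 modnDr.
Qed.

Theorem proposition7p1 (K : fieldType) (charK : 2%N \notin [pchar K])
    (V : vectType K) (q : quadratic_form V) (q_nondeg : nondegenerate_qf q)
    (n : nat) (dimV : \dim {: V} = n) (n_even : ~~ odd n)
    (sigma : 'End(V)) (sigma_sym : orthogonal_symmetry q sigma)
    (s : nat) (dim_minus : \dim (minus_space sigma) = s)
    (J : clifford q -> clifford q) (J_sigma : is_clifford_involution sigma J) :
  orthogonal_involution J <->
  ((n%:Z - 2 * s%:Z = 0 %[mod 8])%Z \/ (n%:Z - 2 * s%:Z = 2 %[mod 8])%Z).
Proof.
have K2 : (2 : K) != 0 by move: charK; rewrite inE.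
have [] := orthogonal_eigenbasis K2 q_nondeg sigma_sym.
rewrite dimV dim_minus => e [M [e_basis e_orth e_neq0 se cardM]].
set k := (n./2 + 3 * s)%N.
(* ['C(k, 2)] is even iff [k] is 0 or 1 modulo 4. Since 3 is -1 modulo 4, this says that [n./2 - s]
   is 0 or 1 modulo 4. *)
suff -> : orthogonal_involution J <-> ~~ odd 'C(k, 2).
  by rewrite odd_bin2 /k; split; lia.
have sgnE := splitting_sign K2 n_even e_basis e_orth e_neq0 J_sigma se.
rewrite cardM -/k in sgnE.
have [J_inv _] := J_sigma.
split=> [[_ [L [iota [m [phi [B [spl uB trB adj]]]]]]]|k_even].
  (* A symmetric [B] means [d = 1], and an odd exponent would give [1 = -1] in [L]. *)
  have := sgnE L iota m phi B 1 spl uB; rewrite scale1r => /(_ trB adj).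
  rewrite -signr_odd; case: (odd _) => //= /eqP; rewrite expr1 -addr_eq0.
  by rewrite -(rmorph1 iota) -rmorphD fmorph_eq0 (negPf (K2 : 1 + 1 != 0)).
have [L [iota [m [phi [B [l [spl uB trB adj]]]]]]] :=
  clifford_symmetric_splitting K2 n_even e_basis e_orth e_neq0 J_sigma se.
split=> //; exists L, iota, m, phi, B; split=> //.
(* The forced sign is 1, so this [B] is symmetric. *)
rewrite trB (sgnE L iota m phi B _ spl uB trB adj).
by rewrite -signr_odd (negPf k_even) scale1r.
Qed.
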